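(* Let $(\Lambda,\Gamma,\lambda)$ be a hard-constraint point process with $q\in\mathbb{N}_{\ge1}$ particle types. Assume there is some $\kappa\in(0,1]$ such that for all $\varepsilon\in\mathbb{R}_{>0}$ there is a $\kappa$-$\varepsilon$-partitioning of $\Lambda$ of size $\mathrm{poly}\bigl(\frac{\mathrm{vol}(\Lambda)}{\varepsilon}\bigr)$. Then for all $\varepsilon_D\in(0,1]$ and $p\in(0,1]$ there is some $n_{\varepsilon_D,p}\in\mathrm{poly}\bigl(\frac{\mathrm{vol}(\Lambda)}{\varepsilon_Dp}\bigr)$ such that for all $n\ge n_{\varepsilon_D,p}$, if $X\subset\Lambda$ with $|X|=n$ is drawn uniformly at random, then with probability at least $1-p$ \[ e^{-\varepsilon_D}Z_\Lambda(\Gamma,\lambda)\le Z_{G_X}(w_X)\le e^{\varepsilon_D}Z_\Lambda(\Gamma,\lambda). \]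
   Context: A hard-constraint point process is $(\Lambda,\Gamma,\lambda)$ with $\Lambda\subset\mathbb{R}^d$ bounded measurable with positive volume (not assumed star-convex), $\Gamma\in\mathbb{R}_{\ge0}^{q\times q}$ symmetric, $\lambda:[q]\to\mathbb{R}_{\ge0}$; $Z_\Lambda(\Gamma,\lambda)=\sum_{k\in\mathbb{N}}\frac{1}{k!}\sum_{\tau:[k]\to[q]}\bigl(\prod_i\lambda(\tau(i))\bigr)\int_{\Lambda^k}\prod_{1\le i<j\le k}\mathbb{1}[\|x_i-x_j\|\ge\Gamma(\tau(i),\tau(j))]\,d\mathbf{x}$ (the $k=0$ term is $1$). For finite nonempty $X\subseteq\Lambda$, $(G_X,w_X)$ is the graph on $\{(x,i):x\in X,i\in[q]\}$ with $(x,i)\sim(y,j)$ iff $(x,i)\ne(y,j)$ and $\|x-y\|<\Gamma(i,j)$, weights $w_X((x,i))=\lambda(i)\mathrm{vol}(\Lambda)/|X|$, and $Z_G(w)=\sum_{I\text{ independent}}\prod_{v\in I}w(v)$. A $\kappa$-$\varepsilon$-partitioning of size $m$ is a partition of $\Lambda$ into $m$ measurable sets, each of volume at least $\kappa\,\mathrm{vol}(\Lambda)/m$ and diameter at most $\varepsilon$. $X$ uniformly at random means $n$ independent uniform points in $\Lambda$. Polynomial bounds are in the displayed quantities, with $d,q,\Gamma,\lambda$ fixed. *)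

(* Defs.v *)
From HB Require Import structures.
From mathcomp Require Import all_boot all_order all_algebra.
From mathcomp Require Import finmap.
From mathcomp Require Import all_classical all_reals all_analysis.

Set Implicit Arguments.
Unset Strict Implicit.
Unset Printing Implicit Defensive.
Import Order.TTheory GRing.Theory Num.Theory.
Import numFieldNormedType.Exports.

Local Open Scope classical_set_scope.
Local Open Scope ring_scope.

(* The library has the product sigma-algebra on n.-tuple T but no n-fold
   product measure: it is built here by iterating the binary product and
   transporting along the bijection T * n.-tuple T -> n.+1.-tuple T. *)
Section power_measure.
Context {dT : measure_display} {T : measurableType dT} {R : realType}.

Definition tcons (n : nat) (p : T * n.-tuple T) : n.+1.-tuple T :=
  cons_tuple p.1 p.2.

Lemma measurable_tcons n : measurable_fun [set: T * n.-tuple T] (@tcons n).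
Proof.
exact: (measurable_cons (f := fst) (g := snd) measurable_fst measurable_snd).
Qed.

Definition tuncons (n : nat) (t : n.+1.-tuple T) : T * n.-tuple T :=
  (thead t, [tuple of behead t]).

Lemma measurable_tuncons n : measurable_fun [set: n.+1.-tuple T] (@tuncons n).
Proof.
apply: (measurable_fun_pair (f := fun t => thead t)
  (g := fun t => [tuple of behead t])); first exact: measurable_tnth.
exact: measurable_behead.
Qed.

Lemma tconsK n : cancel (@tcons n) (@tuncons n).
Proof.
by move=> -[x t]; congr pair; apply: val_inj.
Qed.

Section step.
Variables (mu : {sigma_finite_measure set T -> \bar R}) (n : nat).
Variable nu : {sigma_finite_measure set (n.-tuple T) -> \bar R}.

Definition mcons : set (n.+1.-tuple T) -> \bar R :=
  pushforward (mu \x nu)%E (@tcons n).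

Let preimage_tconsE (A : set (n.+1.-tuple T)) : measurable A ->
  measurable (@tcons n @^-1` A).
Proof. by move=> mA; rewrite -[X in measurable X]setTI; exact: measurable_tcons. Qed.

Let mcons0 : mcons set0 = 0%E.
Proof. by rewrite /mcons /pushforward preimage_set0 measure0. Qed.

Let mcons_ge0 A : (0 <= mcons A)%E.
Proof. exact: (measure_ge0 (mu \x nu)%E). Qed.

Let mcons_sigma_additive : semi_sigma_additive mcons.
Proof.
move=> F mF tF mUF; rewrite /mcons /pushforward preimage_bigcup.
apply: (@measure_semi_sigma_additive _ _ _ (mu \x nu)%E).
- by move=> i; exact: preimage_tconsE.
- apply/trivIsetP => i j _ _ ij; rewrite -preimage_setI.
  by move/trivIsetP : tF => /(_ _ _ Logic.I Logic.I ij) ->; rewrite preimage_set0.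
- by rewrite -preimage_bigcup; exact: preimage_tconsE.
Qed.

HB.instance Definition _ :=
  isMeasure.Build _ _ _ mcons mcons0 mcons_ge0 mcons_sigma_additive.

Let mcons_sigma_finite : sigma_finite setT mcons.
Proof.
have /sigma_finiteP[F [TF ndF Foo]] := sigma_finiteT mu.
have /sigma_finiteP[G [TG ndG Goo]] := sigma_finiteT nu.
exists (fun i => @tuncons n @^-1` (F i `*` G i)).
  rewrite -preimage_bigcup (_ : \bigcup_i _ = setT) ?preimage_setT//.
  apply/seteqP; split=> // -[x t] _.
  have [i _ Fx] : (\bigcup_i F i) x by rewrite -TF.
  have [j _ Gt] : (\bigcup_i G i) t by rewrite -TG.
  exists (maxn i j) => //; split.
    by move: x Fx; exact/subsetPset/ndF/leq_maxl.
  by move: t Gt; exact/subsetPset/ndG/leq_maxr.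
move=> i; have [mF Fi] := Foo i; have [mG Gi] := Goo i; split.
  rewrite -[X in measurable X]setTI; apply: measurable_tuncons => //.
  exact: measurableX.
rewrite /mcons /pushforward -comp_preimage (_ : _ \o _ = id) ?preimage_id.
  by rewrite product_measure1E// lte_mul_pinfty// ge0_fin_numE.
by apply/funext => p /=; rewrite tconsK.
Qed.

HB.instance Definition _ :=
  Measure_isSigmaFinite.Build _ _ _ mcons mcons_sigma_finite.

End step.

Fixpoint mpower (mu : {sigma_finite_measure set T -> \bar R}) (n : nat) :
    {sigma_finite_measure set (n.-tuple T) -> \bar R} :=
  match n with
  | 0 => dirac [tuple]
  | n'.+1 => mcons mu (mpower mu n')
  end.

Lemma mpower_box (mu : {sigma_finite_measure set T -> \bar R}) (n : nat)
    (A : 'I_n -> set T) : (forall i, measurable (A i)) ->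
  mpower mu n [set t | forall i, A i (tnth t i)] = (\prod_(i < n) mu (A i))%E.
Proof.
elim: n A => [|n IH] A mA.
  by rewrite big_ord0 /= diracE mem_set// => -[].
rewrite big_ord_recl /= /mcons /pushforward.
rewrite -(IH (fun i => A (lift ord0 i)))//.
set B := [set t : n.-tuple T | forall i, A (lift ord0 i) (tnth t i)].
have mB : measurable B.
  rewrite (_ : B = \bigcap_(i in [set: 'I_n])
      ((fun t => tnth t i) @^-1` A (lift ord0 i))); last first.
    by apply/seteqP; split=> t /= Bt i; move: (Bt i) => // /(_ I).
  apply: fin_bigcap_measurable => [|i _]; first exact: finite_finset.
  by rewrite -[X in measurable X]setTI; exact: measurable_tnth.
rewrite -product_measure1E//; congr ((_ \x _)%E _).
apply/seteqP; split => -[x t] /=.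
  move=> At; split; first by have := At ord0.
  by move=> i; have := At (lift ord0 i); rewrite tnthS.
move=> [Ax Bt] i; case: (unliftP ord0 i) => [j ->|->]; last by [].
by rewrite tnthS; exact: Bt.
Qed.

End power_measure.

Section euclidean_space.
Context {R : realType} {d : nat}.
Local Notation E := (d.-tuple (measurableTypeR R)).

(* Points of R^d are d-tuples, with the product of the Borel sigma-algebras. *)
Definition vol : {sigma_finite_measure set E -> \bar R} :=
  mpower lebesgue_measure d.

(* Euclidean distance; the library's norm on row vectors is the sup norm. *)
Definition eucl_dist (x y : E) : R :=
  Num.sqrt (\sum_(i < d) ((tnth x i : R) - (tnth y i : R)) ^+ 2).

Definition diam (A : set E) : \bar R :=
  ereal_sup [set (eucl_dist p.1 p.2)%:E | p in A `*` A].

Definition partitioning (L : set E) (kappa eps : R) (m : nat)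
    (F : 'I_m -> set E) : Prop :=
  [/\ forall i, measurable (F i),
      trivIset [set: 'I_m] F,
      \bigcup_i F i = L,
      forall i, (kappa%:E * vol L * (m%:R^-1)%:E <= vol (F i))%E &
      forall i, (diam (F i) <= eps%:E)%E].

(* The default probability [dirac point] is only used by [mnormalize] when
   [vol L] is zero or infinite. *)
Definition uniform_on (L : set E) (mL : measurable L) : probability E R :=
  mnormalize (mrestr vol mL) (dirac point).

Definition uniform_points (L : set E) (mL : measurable L) (n : nat) :
    {sigma_finite_measure set (n.-tuple E) -> \bar R} :=
  mpower (uniform_on mL) n.

Definition partition_function (L : set E) (q : nat) (Gam : 'M[R]_q)
    (lam : 'I_q -> R) : \bar R :=
  (\sum_(0 <= k <oo)
     ((k`!%:R^-1)%:E *
      \sum_(tau : {ffun 'I_k -> 'I_q})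
        ((\prod_(i < k) lam (tau i))%R%:E *
         \int[mpower vol k]_(x in [set x | forall i, L (tnth x i)])
           (\prod_(i < k) \prod_(j < k | (i < j)%N)
              (Gam (tau i) (tau j) <= eucl_dist (tnth x i) (tnth x j))%R%:R)%R%:E)))%E.

End euclidean_space.

Section hard_core_model.
Context {R : realType} {V : finType}.

Definition independent (e : rel V) (I : {set V}) : bool :=
  [forall u in I, forall v in I, ~~ e u v].

Definition hard_core_partition_function (e : rel V) (w : V -> R) : R :=
  \sum_(I : {set V} | independent e I) \prod_(v in I) w v.

End hard_core_model.

Section discretization.
Context {R : realType} {d q : nat}.
Local Notation E := (d.-tuple (measurableTypeR R)).
Variables (L : set E) (Gam : 'M[R]_q) (lam : 'I_q -> R).

Definition graph_of (X : {fset E}) : rel (X * 'I_q) :=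
  fun u v => (u != v) && (eucl_dist (val u.1) (val v.1) < Gam u.2 v.2).

Definition weight_of (X : {fset E}) (v : X * 'I_q) : R :=
  lam v.2 * fine (vol L) / #|` X|%:R.

Definition graph_partition_function (X : {fset E}) : R :=
  hard_core_partition_function (@graph_of X) (@weight_of X).

End discretization.

(* Coinciding coordinates collapse, so this has n elements outside the null
   event that two of the n points are equal. *)
Definition point_set {R : realType} {d n : nat}
    (x : n.-tuple (d.-tuple (measurableTypeR R))) :
    {fset d.-tuple (measurableTypeR R)} :=
  [fset tnth x i | i in 'I_n]%fset.

(* Main.v *)
(* Let V = vol L, s = V * sum lam and f(x_1, ..., x_n) = Z_{G_X}(w_X).  Revealing
   the points one at a time gives the deletion-contraction recursion [hc], in
   which the particles already placed act as a boundary condition eta.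
   Mean: let u_k be the mean weight of k ordered particles at uniform points, so
   that Z = sum_k V^k u_k / k!.  Pascal's rule turns the recursion with at most
   one particle per point into sum_k 'C(n, k) (V/n)^k u_k, which lies within a
   factor 1 - s^2/(2n) of Z because u_{k+1} <= (sum lam) u_k.  Several particles
   at one point contribute at most a factor exp(2 s^2/n).
   Variance: forgetting one point changes f by a factor between 1 and 1 + c with
   c <= 2 s/n.  A random variable with values in [g, (1 + c) g] satisfies
   E h^2 <= (1 + c^2/4) (E h)^2, and this tensorizes over the n independent
   points: E f^2 <= exp(s^2/n) (E f)^2.  Chebyshev's inequality then gives the
   claim as soon as n >= 32 s^2 / (p epsD^2). *)
Require Import Defs.
From mathcomp Require Import all_boot all_order all_algebra.
From mathcomp Require Import finmap.
From mathcomp Require Import all_classical all_reals all_analysis.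
From mathcomp Require Import measurable_realfun ring lra.

Set Implicit Arguments.
Unset Strict Implicit.
Unset Printing Implicit Defensive.
Import Order.TTheory GRing.Theory Num.Theory.
Import numFieldNormedType.Exports.

Local Open Scope ring_scope.

(** * Deletion-contraction for the hard-core model *)

(** Placing a particle changes the constraints on everything revealed later, so no estimate closes
    for the empty boundary condition alone: each comparison is proved for all [eta] at once, and the
    step from n to n + 1 points is carried by a linear, monotone operator acting on functions of
    [eta]. Over each sampled point sit q vertices, and those of types a and b are adjacent only if
    Gam a b is positive; several particles may therefore share a point. The vertices over one point
    have total weight x = s/n, so multiple occupancy has weight of order x^2 per point and of order
    s^2/n over all n points. The variance works for the same reason: the influence of a point is
    relative, of order x, and enters squared, so that n points again cost s^2/n in the exponent. An
    absolute bound on the change of f would have to be compared with the size of Z. Coinciding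
    points would alter the weights, which are divided by |X|; they form a null event that is removed
    at the end. *)

Section deletion_contraction.
Context {R : realFieldType} {V : Type}.
Variables (e : rel V) (w : V -> R).

(* Partition function of the graph induced on [s], restricted to the
   independent sets without neighbours in [eta]. *)
Fixpoint hc (s eta : seq V) : R :=
  if s is v :: s' then
    hc s' eta + (~~ has (e v) eta)%:R * (w v * hc s' (v :: eta))
  else 1.

Hypothesis w_ge0 : forall v, 0 <= w v.

Lemma hc_ge1 s eta : 1 <= hc s eta.
Proof.
elim: s eta => [|v s IH] eta //=.
by rewrite (le_trans (IH eta))// lerDl !mulr_ge0// (le_trans _ (IH _)).
Qed.

Lemma hc_ge0 s eta : 0 <= hc s eta.
Proof. exact: le_trans (hc_ge1 _ _). Qed.

(** The hypothesis compares blocked vertices rather than lists; in this form it survives adding the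
    same vertex to both sides. *)
Lemma hc_anti s eta1 eta2 : (forall v, has (e v) eta1 -> has (e v) eta2) ->
  hc s eta2 <= hc s eta1.
Proof.
elim: s eta1 eta2 => [|v s IH] eta1 eta2 H //=.
apply: lerD; first exact: IH.
apply: ler_pM => //; first by rewrite mulr_ge0// hc_ge0.
  have := H v; case: (has _ eta1) => [/(_ isT) ->//|_].
  by case: has; rewrite ?ler01 ?lexx.
apply: ler_wpM2l => //; apply: IH => u /=.
by case: (e u v) => //=; exact: H.
Qed.

Lemma hc_cons_le s v eta : hc s (v :: eta) <= hc s eta.
Proof. by apply: hc_anti => u /= ->; rewrite orbT. Qed.

Lemma hc_cat_ge s1 s2 eta : hc s2 eta <= hc (s1 ++ s2) eta.
Proof.
elim: s1 => [|v s1 IH] //=.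
by rewrite (le_trans IH)// lerDl !mulr_ge0// hc_ge0.
Qed.

(** Occupying a vertex only enlarges the boundary condition, so each vertex of [s1] contributes at
    most a factor [1 + w v]. *)
Lemma hc_cat_le s1 s2 eta :
  hc (s1 ++ s2) eta <= \prod_(v <- s1) (1 + w v) * hc s2 eta.
Proof.
elim: s1 eta => [|v s1 IH] eta /=; first by rewrite big_nil mul1r.
rewrite big_cons mulrDl mul1r mulrDl; apply: lerD => //.
rewrite -mulrA; apply: le_trans (_ : w v * hc (s1 ++ s2) eta <= _).
  rewrite -[leRHS]mul1r; apply: ler_pM => //; last 2 first.
  - by case: has.
  - by rewrite ler_wpM2l// hc_cons_le.
  - by rewrite mulr_ge0// hc_ge0.
by rewrite ler_wpM2l.
Qed.

Definition single_occupancy (s1 s2 eta : seq V) : R :=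
  \sum_(v <- s1) (~~ has (e v) eta)%:R * (w v * hc s2 (v :: eta)).

Lemma hc_cat_lower s1 s2 eta :
  hc s2 eta + single_occupancy s1 s2 eta <= hc (s1 ++ s2) eta.
Proof.
rewrite /single_occupancy; elim: s1 => [|v s1 IH] /=.
  by rewrite big_nil addr0.
rewrite big_cons addrCA addrC lerD// ler_wpM2l// ler_wpM2l//.
exact: hc_cat_ge.
Qed.

(** The difference in front is the unconstrained weight of all subsets of [s1] other than
    singletons; only singletons need their exact weight. *)
Lemma hc_cat_upper s1 s2 eta :
  hc (s1 ++ s2) eta <=
    (\prod_(v <- s1) (1 + w v) - \sum_(v <- s1) w v) * hc s2 eta
    + single_occupancy s1 s2 eta.
Proof.
rewrite /single_occupancy; elim: s1 => [|v s1 IH] /=.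
  by rewrite !big_nil subr0 addr0 mul1r.
rewrite !big_cons.
move: IH; set p := \prod_(_ <- _) _; set S := \sum_(_ <- _) w _ => IH.
set b : R := (~~ _)%:R.
have b01 : 0 <= b <= 1 by rewrite /b; case: has => /=; rewrite ?lexx ler01.
have p1 : 1 <= p.
  rewrite /p; elim: (s1) => [|u s' IHs]; rewrite ?big_nil// big_cons.
  by rewrite (le_trans IHs)// mulrDl mul1r lerDl mulr_ge0// (le_trans _ IHs).
have H := hc_cat_le s1 s2 (v :: eta); rewrite -/p in H.
have H1 := hc_cons_le s2 v eta; have H0 := hc_ge0 s2 (v :: eta).
(* With v occupied, the rest of [s1] weighs at most p = 1 + (p - 1): the 1 leaves v alone, and p - 1
   covers at least two occupied vertices. *)
have K : b * (w v * hc (s1 ++ s2) (v :: eta)) <=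
    w v * (p - 1) * hc s2 eta + b * (w v * hc s2 (v :: eta)).
  apply: (@le_trans _ _ (b * (w v * (p * hc s2 (v :: eta))))).
    by rewrite !ler_wpM2l//; case/andP: b01.
  rewrite -lerBlDr -mulrBr -mulrBr -mulrA.
  rewrite -[X in _ * (_ - X)]mul1r -mulrBl.
  apply: (@le_trans _ _ (1 * (w v * ((p - 1) * hc s2 (v :: eta))))).
    by rewrite ler_wpM2r//; [rewrite !mulr_ge0// subr_ge0|case/andP: b01].
  by rewrite mul1r !ler_wpM2l// subr_ge0.
apply: le_trans (lerD IH K) _.
by rewrite le_eqVlt; apply/orP; left; apply/eqP; ring.
Qed.

End deletion_contraction.

Lemma hc_map {R : realFieldType} {V W : Type} (f : V -> W) (e : rel W)
    (w : W -> R) s eta :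
  hc e w (map f s) (map f eta) =
  hc (fun u v => e (f u) (f v)) (fun v => w (f v)) s eta.
Proof.
elim: s eta => [|v s IH] eta //=.
by rewrite IH -map_cons IH has_map.
Qed.

(** [hc] tests a vertex only against those placed before it. Symmetry makes the order irrelevant,
    and since s has no repetition its vertices are never tested against their own copies, so loops
    of [e] inside s do not count. *)
Lemma hc_sum {R : realFieldType} {V : finType} (e : rel V) (w : V -> R)
    (s eta : seq V) : symmetric e -> uniq s ->
  hc e w s eta = \sum_(I : {set V} | [&& I \subset s,
      [forall u in I, forall v in I, ~~ ((u != v) && e u v)] &
      [forall u in I, ~~ has (e u) eta]]) \prod_(v in I) w v.
Proof.
move=> e_sym; elim: s eta => [|v s IH] eta /=.
  move=> _; rewrite (big_pred1 finset.set0) ?finset.big_set0// => I.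
  apply/and3P/eqP => [[sI _ _]|->].
    apply/eqP; rewrite -finset.subset0; apply: fintype.subset_trans sI _.
    exact/fintype.subsetP.
  by split; [apply/fintype.subsetP|apply/forall_inP|apply/forall_inP] => x;
    rewrite inE.
case/andP=> vs us; rewrite [RHS](bigID (fun I : {set V} => v \in I)) /= addrC.
congr (_ + _).
  rewrite IH//; apply: eq_bigl => I.
  have [vI|vI] := boolP (v \in I); rewrite ?andbT ?andbF.
    apply/negbTE/negP => /and3P[/fintype.subsetP/(_ v vI)].
    by rewrite (negbTE vs).
  congr [&& _, _ & _]; apply/fintype.subsetP/fintype.subsetP => sI u uI.
    by rewrite inE sI ?orbT.
  by have := sI u uI; rewrite inE => /orP[/eqP uv|//]; rewrite -uv uI in vI.
have [hv|hv] /= := boolP (has (e v) eta).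
  rewrite mul0r big1// => I /andP[/and3P[_ _ /forall_inP H] vI].
  by have := H v vI; rewrite hv.
rewrite mul1r IH// big_distrr /=.
rewrite [RHS](reindex_onto (fun I => v |: I) (fun I => I :\ v)) /=; last first.
  by move=> I /andP[_ vI]; rewrite finset.setD1K.
apply: eq_big => I.
  have [vI|vI] := boolP (v \in I).
    transitivity false.
      apply/negbTE/negP => /and3P[/fintype.subsetP/(_ v vI)].
      by rewrite (negbTE vs).
    apply/esym/negbTE; rewrite negb_and; apply/orP; right.
    by apply: contraTneq vI => <-; rewrite !inE eqxx.
  rewrite finset.setU1K// eqxx finset.setU11 !andbT.
  apply/and3P/and3P => -[/fintype.subsetP sI /forall_inP iI /forall_inP cI]; split.
  - by apply/fintype.subsetP => u; rewrite !inE => /orP[->//|/sI ->]; rewrite orbT.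
  - apply/forall_inP => a; rewrite inE => /orP[]; last first.
      move=> aI; apply/forall_inP => b; rewrite inE => /orP[].
        rewrite inE => /eqP ->; have := cI a aI.
        rewrite /= negb_or => /andP[/negbTE -> _].
        by rewrite andbF.
      by move=> bI; exact: (forall_inP (iI a aI)).
    rewrite inE => /eqP ->; apply/forall_inP => b; rewrite inE => /orP[].
      by rewrite inE => /eqP ->; rewrite eqxx.
    move=> bI; have := cI b bI; rewrite /= negb_or e_sym => /andP[/negbTE -> _].
    by rewrite andbF.
  - apply/forall_inP => a; rewrite !inE => /orP[/eqP ->//|aI].
    by have := cI a aI; rewrite /= negb_or => /andP[].
  - apply/fintype.subsetP => u uI; have := sI u; rewrite !inE uI orbT => /(_ isT).
    by case/orP => // /eqP uv; rewrite -uv uI in vI.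
  - apply/forall_inP => a aI; apply/forall_inP => b bI.
    have /forall_inP := iI a (finset.setU1r _ aI); apply; exact: finset.setU1r.
  - apply/forall_inP => a aI /=; rewrite negb_or cI ?finset.setU1r// andbT.
    have /forall_inP/(_ v (finset.setU11 _ _)) := iI a (finset.setU1r _ aI).
    by rewrite (_ : a != v)//; apply: contraNneq vI => <-.
case/and3P => /fintype.subsetP sI _ _; rewrite finset.big_setU1//.
by apply/negP => /sI; rewrite (negbTE vs).
Qed.

(** * Weights of point configurations with types *)

Section point_configurations.
Context {R : realFieldType} {T : Type} {q : nat}.
Variables (e : rel (T * 'I_q)) (lam : 'I_q -> R).
Hypothesis lam_ge0 : forall a, 0 <= lam a.

(** The vertices over one point are consecutive, so revealing a point prepends a block. *)
Definition vertices (s : seq T) : seq (T * 'I_q) :=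
  [seq (x, a) | x <- s, a <- enum 'I_q].

(* Summing over all type assignments gives the weight of placing exactly one
   particle at each point of [s], in presence of the particles [eta]. *)
Fixpoint full_weight (s : seq T) (eta : seq (T * 'I_q)) : R :=
  if s is x :: s' then
    \sum_a (~~ has (e (x, a)) eta)%:R * (lam a * full_weight s' ((x, a) :: eta))
  else 1.

Lemma full_weight_ge0 s eta : 0 <= full_weight s eta.
Proof.
elim: s eta => [|x s IH] eta //=; apply: sumr_ge0 => a _.
by rewrite !mulr_ge0.
Qed.

Lemma full_weight_anti s eta1 eta2 :
  (forall v, has (e v) eta1 -> has (e v) eta2) ->
  full_weight s eta2 <= full_weight s eta1.
Proof.
elim: s eta1 eta2 => [|x s IH] eta1 eta2 H //=.
apply: ler_sum => a _; apply: ler_pM => //.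
- by rewrite mulr_ge0// full_weight_ge0.
- have := H (x, a); case: (has _ eta1) => [/(_ isT) ->//|_].
  by case: has; rewrite ?ler01 ?lexx.
apply: ler_wpM2l => //; apply: IH => v /=.
by case: (e v (x, a)) => //=; exact: H.
Qed.

End point_configurations.

Local Open Scope classical_set_scope.

(** * Expectation of bounded nonnegative functions *)

Section expectation.
Context {d : measure_display} {T : measurableType d} {R : realType}.

(** Boundedness makes expectations under a probability finite, and nonnegativity lets Tonelli apply
    without integrability conditions; hence [expect] can be real-valued. *)
Definition bounded_ge0 (f : T -> R) : Prop :=
  [/\ measurable_fun setT f, forall x, 0 <= f x & exists B, forall x, f x <= B].

Definition expect (mu : {measure set T -> \bar R}) (f : T -> R) : R :=
  fine (\int[mu]_x (f x)%:E).

Lemma bounded_ge0_cst (c : R) : 0 <= c -> bounded_ge0 (fun=> c).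
Proof. by move=> c0; split => //; exists c. Qed.

Lemma eq_bounded_ge0 (f g : T -> R) : f =1 g -> bounded_ge0 f -> bounded_ge0 g.
Proof. by move=> /funext ->. Qed.

Lemma bounded_ge0D (f g : T -> R) :
  bounded_ge0 f -> bounded_ge0 g -> bounded_ge0 (fun x => f x + g x).
Proof.
move=> [mf f0 [B fB]] [mg g0 [C gC]]; split.
- exact: measurable_funD.
- by move=> x; rewrite addr_ge0.
- by exists (B + C) => x; rewrite lerD.
Qed.

Lemma bounded_ge0M (f g : T -> R) :
  bounded_ge0 f -> bounded_ge0 g -> bounded_ge0 (fun x => f x * g x).
Proof.
move=> [mf f0 [B fB]] [mg g0 [C gC]]; split.
- exact: measurable_funM.
- by move=> x; rewrite mulr_ge0.
- by exists (B * C) => x; rewrite ler_pM.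
Qed.

Lemma bounded_ge0Z (c : R) (f : T -> R) :
  0 <= c -> bounded_ge0 f -> bounded_ge0 (fun x => c * f x).
Proof. by move=> c0; apply: bounded_ge0M; exact: bounded_ge0_cst. Qed.

Lemma bounded_ge0_sum (I : Type) (s : seq I) (f : I -> T -> R) :
  (forall i, bounded_ge0 (f i)) -> bounded_ge0 (fun x => \sum_(i <- s) f i x).
Proof.
move=> bf; elim: s => [|i s IH].
  under eq_fun do rewrite big_nil.
  exact: bounded_ge0_cst.
under eq_fun do rewrite big_cons.
exact: bounded_ge0D.
Qed.

Lemma bounded_ge0_prod (I : Type) (s : seq I) (P : pred I) (f : I -> T -> R) :
  (forall i, bounded_ge0 (f i)) ->
  bounded_ge0 (fun x => \prod_(i <- s | P i) f i x).
Proof.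
move=> bf; elim: s => [|i s IH].
  under eq_fun do rewrite big_nil.
  exact: bounded_ge0_cst.
under eq_fun do rewrite big_cons.
by case: (P i) => //; exact: bounded_ge0M.
Qed.

Lemma bounded_ge0_bool (b : T -> bool) : measurable_fun setT b ->
  bounded_ge0 (fun x => (b x)%:R).
Proof.
move=> mb; split => //; last by exists 1 => x; case: (b x); rewrite ?ler01.
rewrite (_ : (fun x => _) = \1_(b @^-1` [set true])).
  by apply: measurable_indic; rewrite -[X in measurable X]setTI; exact: mb.
apply/funext => x; rewrite indicE; congr (nat_of_bool _)%:R.
by apply/idP/idP; rewrite inE /=.
Qed.

Variable mu : {measure set T -> \bar R}.
Hypothesis mu1 : mu setT = 1%E.

Lemma expectE f : bounded_ge0 f -> (\int[mu]_x (f x)%:E = (expect mu f)%:E)%E.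
Proof.
move=> [mf f0 [B fB]]; rewrite /expect fineK// ge0_fin_numE; last first.
  by apply: integral_ge0 => x _; rewrite lee_fin.
apply: (@le_lt_trans _ _ (\int[mu]_x (cst B%:E x))%E).
  apply: ge0_le_integral => //; first by move=> x _; rewrite lee_fin.
    exact/measurable_EFinP.
  by move=> x _; rewrite lee_fin.
by rewrite integral_cst// mu1 mule1 ltry.
Qed.

Lemma expect_ge0 f : (forall x, 0 <= f x) -> 0 <= expect mu f.
Proof.
by move=> f0; apply: fine_ge0; apply: integral_ge0 => x _; rewrite lee_fin.
Qed.

Lemma expect_cst c : expect mu (fun=> c) = c.
Proof. by rewrite /expect (integral_cst _ _ c%:E)// mu1 mule1. Qed.

Lemma le_expect f g : bounded_ge0 f -> bounded_ge0 g ->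
  (forall x, f x <= g x) -> expect mu f <= expect mu g.
Proof.
move=> bf bg fg; rewrite -lee_fin -!expectE//.
case: bf bg => mf f0 _ [mg g0 _]; apply: ge0_le_integral => //.
- by move=> x _; rewrite lee_fin.
- exact/measurable_EFinP.
- exact/measurable_EFinP.
- by move=> x _; rewrite lee_fin.
Qed.

Lemma expectD f g : bounded_ge0 f -> bounded_ge0 g ->
  expect mu (fun x => f x + g x) = expect mu f + expect mu g.
Proof.
move=> bf bg; have bfg := bounded_ge0D bf bg.
apply: EFin_inj; rewrite EFinD -!expectE//.
case: bf bg => mf f0 _ [mg g0 _]; rewrite -ge0_integralD//.
- by move=> x _; rewrite lee_fin.
- exact/measurable_EFinP.
- by move=> x _; rewrite lee_fin.
- exact/measurable_EFinP.
Qed.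

Lemma expectZ c f : 0 <= c -> bounded_ge0 f ->
  expect mu (fun x => c * f x) = c * expect mu f.
Proof.
move=> c0 bf; have bcf := bounded_ge0Z c0 bf.
apply: EFin_inj; rewrite EFinM -!expectE//.
case: bf => mf f0 _; rewrite -ge0_integralZl//.
- exact/measurable_EFinP.
- by move=> x _; rewrite lee_fin.
Qed.

Lemma expect_sum (I : Type) (s : seq I) (f : I -> T -> R) :
  (forall i, bounded_ge0 (f i)) ->
  expect mu (fun x => \sum_(i <- s) f i x) = \sum_(i <- s) expect mu (f i).
Proof.
move=> bf; elim: s => [|i s IH].
  rewrite big_nil -[RHS](expect_cst 0); congr expect.
  by apply/funext => x; rewrite big_nil.
rewrite big_cons -IH -expectD//; last exact: bounded_ge0_sum.
by congr expect; apply/funext => x; rewrite big_cons.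
Qed.

Lemma expect_indic A : measurable A -> (expect mu (\1_A))%:E = mu A.
Proof.
move=> mA; rewrite -expectE; first by rewrite integral_indic// setIT.
split; first exact: measurable_indic.
  by move=> x; rewrite indicE.
by exists 1 => x; rewrite indicE; case: (_ \in _).
Qed.

End expectation.

Lemma bounded_ge0_comp {d1 d2 : measure_display} {S : measurableType d1}
    {T : measurableType d2} {R : realType} (f : T -> R) (g : S -> T) :
  measurable_fun setT g -> bounded_ge0 f -> bounded_ge0 (fun x => f (g x)).
Proof.
move=> mg [mf f0 [B fB]]; split => //; last by exists B.
exact: measurableT_comp.
Qed.

Lemma bounded_ge0_expect {d1 d2 : measure_display} {S : measurableType d1}
    {T : measurableType d2} {R : realType}
    (nu : {sigma_finite_measure set T -> \bar R}) (f : S -> T -> R) :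
  nu setT = 1%E -> bounded_ge0 (fun p : S * T => f p.1 p.2) ->
  bounded_ge0 (fun x => expect nu (f x)).
Proof.
move=> nu1 [mf f0 [B fB]]; split.
- have := @measurable_fun_fubini_tonelli_F _ _ S T R nu
    (fun p => (f p.1 p.2)%:E); rewrite /fubini_F /= => mF.
  apply: measurableT_comp => //; apply: mF; last by move=> p; rewrite lee_fin f0.
  exact/measurable_EFinP.
- by move=> x; apply: expect_ge0 => y; exact: (f0 (x, y)).
- exists B => x; rewrite -[B](expect_cst nu1); apply: le_expect => //.
  + split; last by exists B => y; exact: (fB (x, y)).
      exact: (measurableT_comp mf (measurable_pair1 x)).
    by move=> y; exact: (f0 (x, y)).
  + apply: bounded_ge0_cst; exact: le_trans (f0 (x, point)) (fB _).
  + by move=> y; exact: (fB (x, y)).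
Qed.

(** * Integration against power measures, one coordinate at a time *)

Section power_measure_theory.
Context {dT : measure_display} {T : measurableType dT} {R : realType}.

Lemma mpowerT (mu : {sigma_finite_measure set T -> \bar R}) n :
  mu setT = 1%E -> mpower mu n setT = 1%E.
Proof.
move=> mu1; have := mpower_box mu (fun _ : 'I_n => @measurableT _ T).
by rewrite big1// => <-; congr (mpower _ _ _); apply/seteqP; split.
Qed.

Lemma integral_mpowerS (mu : {sigma_finite_measure set T -> \bar R}) n
    (f : n.+1.-tuple T -> \bar R) : measurable_fun setT f ->
  (forall x, (0 <= f x)%E) ->
  (\int[mpower mu n.+1]_x f x =
   \int[mu]_x \int[mpower mu n]_t f (tcons (x, t)))%E.
Proof.
move=> mf f0; rewrite /= /mcons ge0_integral_pushforward//=; last first.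
  exact: measurable_tcons.
rewrite preimage_setT fubini_tonelli1//.
exact: (measurableT_comp mf (@measurable_tcons _ _ n)).
Qed.

Lemma expect_mpowerS (mu : {sigma_finite_measure set T -> \bar R}) n f :
  mu setT = 1%E -> bounded_ge0 f ->
  expect (mpower mu n.+1) f =
  expect mu (fun x => expect (mpower mu n) (fun t => f (tcons (x, t)))).
Proof.
move=> mu1 bf; have [mf f0 _] := bf.
have bf' := bounded_ge0_comp (@measurable_tcons _ _ n) bf.
rewrite [in LHS]/expect integral_mpowerS//; last exact/measurable_EFinP.
congr fine; apply: eq_integral => x _.
rewrite expectE//; first exact: mpowerT.
exact: (bounded_ge0_comp (measurable_pair1 x) bf').
Qed.

(* [A] and [B] need not be measurable: the integral of a nonnegative function
   is a supremum over the simple functions below it. *)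
Lemma mpower_mono (mu : {sigma_finite_measure set T -> \bar R}) n A B :
  A `<=` B -> (mpower mu n A <= mpower mu n B)%E.
Proof.
elim: n A B => [|n IH] A B AB.
  rewrite /= !diracE lee_fin ler_nat; have [|//] := boolP ([tuple] \in A).
  by move=> /set_mem/AB/mem_set ->.
change (\int[mu]_x mpower mu n (xsection (@tcons _ _ n @^-1` A) x) <=
  \int[mu]_x mpower mu n (xsection (@tcons _ _ n @^-1` B) x))%E.
rewrite !ge0_integralTE//.
apply: ereal_sup_le => _ [h /= hA <-]; exists h => //= x.
apply: le_trans (hA x) _; apply: IH => t /=.
by rewrite /xsection /= !inE; exact: AB.
Qed.

End power_measure_theory.

(** * Variance under bounded influence *)

Section bounded_influence.
Context {dT : measure_display} {T : measurableType dT} {R : realType}.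

(* Changing one coordinate multiplies [f] by a factor between [(1 + c)^-1] and
   [1 + c]. *)
Fixpoint bounded_influence (c : R) (n : nat) : (n.-tuple T -> R) -> Prop :=
  if n is n'.+1 then fun f =>
    (forall x, bounded_influence c (fun t : n'.-tuple T => f (tcons (x, t)))) /\
    exists g, bounded_ge0 g /\
      forall x t, g t <= f (tcons (x, t)) <= (1 + c) * g t
  else fun _ => True.

(** The witnesses g add up with the functions; deletion-contraction expands [hc] into nonnegative
    combinations of this kind. *)
Lemma bounded_influenceD c n (f1 f2 : n.-tuple T -> R) :
  bounded_influence c f1 -> bounded_influence c f2 ->
  bounded_influence c (fun t => f1 t + f2 t).
Proof.
elim: n f1 f2 => [|n IH] f1 f2 //= [if1 [g1 [bg1 fg1]]] [if2 [g2 [bg2 fg2]]].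
split; first by move=> x; exact: IH.
exists (fun t => g1 t + g2 t); split; first exact: bounded_ge0D.
move=> x t; have /andP[? ?] := fg1 x t; have /andP[? ?] := fg2 x t.
by rewrite mulrDr !lerD.
Qed.

Lemma bounded_influenceZ c n a (f : n.-tuple T -> R) : 0 <= a ->
  bounded_influence c f -> bounded_influence c (fun t => a * f t).
Proof.
move=> a0; elim: n f => [|n IH] f //= [if1 [g [bg fg]]].
split; first by move=> x; exact: IH.
exists (fun t => a * g t); split; first exact: bounded_ge0Z.
by move=> x t; have /andP[? ?] := fg x t; rewrite mulrCA !ler_wpM2l.
Qed.

Variable mu : {sigma_finite_measure set T -> \bar R}.
Hypothesis mu1 : mu setT = 1%E.

(** Integrating (h - g)((1 + c) g - h) >= 0 bounds E h^2 by a concave quadratic in g, whose maximum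
    is (1 + c^2 / (4 (1 + c))) (E h)^2. *)
Lemma second_moment_ratio (c g : R) (h : T -> R) : 0 <= c -> 0 <= g ->
  bounded_ge0 h -> (forall x, g <= h x <= (1 + c) * g) ->
  expect mu (fun x => h x ^+ 2) <= (1 + c ^+ 2 / 4) * expect mu h ^+ 2.
Proof.
move=> c0 g0 bh gh; set m := expect mu h.
have bh2 : bounded_ge0 (fun x => h x ^+ 2) := bounded_ge0M bh bh.
have m0 : 0 <= m by apply: expect_ge0; case: bh.
have cg0 : 0 <= (1 + c) * g ^+ 2 by rewrite mulr_ge0 ?sqr_ge0// addr_ge0.
have cg1 : 0 <= (2 + c) * g by rewrite mulr_ge0// addr_ge0.
have : expect mu (fun x => h x ^+ 2 + (1 + c) * g ^+ 2) <=
       expect mu (fun x => (2 + c) * g * h x).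
  apply: le_expect => //.
  - by apply: bounded_ge0D => //; exact: bounded_ge0_cst.
  - exact: bounded_ge0Z.
  - (* [(h - g) * ((1 + c) * g - h) >= 0] *)
    move=> x; have /andP[gx hx] := gh x.
    have : 0 <= (h x - g) * ((1 + c) * g - h x) by rewrite mulr_ge0// subr_ge0.
    by move=> H; rewrite -subr_ge0; apply: le_trans H _; lra.
rewrite expectD//; last exact: bounded_ge0_cst.
rewrite expect_cst// expectZ// -/m => H.
have c41 : 0 < 4 * (1 + c) by lra.
rewrite -(ler_pM2l c41).
have : 4 * (1 + c) * expect mu (fun x => h x ^+ 2) <=
  4 * (1 + c) * ((2 + c) * g * m - (1 + c) * g ^+ 2).
  by rewrite ler_pM2l//; lra.
move=> /le_trans; apply; rewrite -subr_ge0.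
(* The square is completed in g; c^3 m^2 is the slack of replacing c^2 / (4 (1 + c)) by c^2 / 4. *)
rewrite [X in 0 <= X](_ : _ =
  (2 * (1 + c) * g - (2 + c) * m) ^+ 2 + c ^+ 3 * m ^+ 2); last by field.
by rewrite addr_ge0 ?sqr_ge0// mulr_ge0 ?sqr_ge0// exprn_ge0.
Qed.

(** For a fixed first coordinate the induction hypothesis handles the section of f; its mean, as a
    function of that coordinate, then falls under the one-variable bound. *)
Lemma second_moment_mpower (c : R) n (f : n.-tuple T -> R) : 0 <= c ->
  bounded_ge0 f -> bounded_influence c f ->
  expect (mpower mu n) (fun x => f x ^+ 2) <=
    (1 + c ^+ 2 / 4) ^+ n * expect (mpower mu n) f ^+ 2.
Proof.
move=> c0; have rho0 : 0 <= 1 + c ^+ 2 / 4.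
  by rewrite addr_ge0// divr_ge0 ?sqr_ge0.
elim: n f => [|n IH] f bf.
  move=> _; rewrite expr0 mul1r.
  have fE : f = fun=> f [tuple].
    by apply/funext => t; congr f; rewrite tuple0; exact/esym/tuple0.
  by rewrite fE !expect_cst//; exact: mpowerT.
case=> infl [g [bg fg]].
have bf2 : bounded_ge0 (fun x => f x ^+ 2) := bounded_ge0M bf bf.
have bft := bounded_ge0_comp (@measurable_tcons _ _ n) bf.
have bf2t := bounded_ge0_comp (@measurable_tcons _ _ n) bf2.
have bfx x : bounded_ge0 (fun t => f (tcons (x, t))).
  exact: (bounded_ge0_comp (measurable_pair1 x) bft).
have mun1 := mpowerT n mu1.
pose h x := expect (mpower mu n) (fun t => f (tcons (x, t))).
have bh : bounded_ge0 h.
  by apply: (@bounded_ge0_expect _ _ _ _ _ (mpower mu n)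
    (fun x t => f (tcons (x, t)))) => //.
rewrite !expect_mpowerS// -/(h _).
apply: (@le_trans _ _
    (expect mu (fun x => (1 + c ^+ 2 / 4) ^+ n * h x ^+ 2))).
  apply: le_expect => //.
  - by apply: (@bounded_ge0_expect _ _ _ _ _ (mpower mu n)
      (fun x t => f (tcons (x, t)) ^+ 2)) => //.
  - by apply: bounded_ge0Z; [exact: exprn_ge0|exact: (bounded_ge0M bh bh)].
  - by move=> x; exact: (IH _ (bfx x) (infl x)).
rewrite expectZ//; last 2 first.
  - exact: exprn_ge0.
  - exact: (bounded_ge0M bh bh).
rewrite [_ ^+ n.+1]exprSr -mulrA ler_wpM2l ?exprn_ge0//.
(* Averaging the sandwich over t traps every [h x] between the mean of g and 1 + c times it. *)
apply: (@second_moment_ratio c (expect (mpower mu n) g)) => //.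
  by apply: expect_ge0; case: bg.
move=> x; apply/andP; split.
  by apply: le_expect => // t; case/andP: (fg x t).
rewrite -expectZ//; last by lra.
apply: le_expect => //; first by apply: bounded_ge0Z => //; lra.
by move=> t; case/andP: (fg x t).
Qed.

End bounded_influence.

Lemma chebyshev_ratio {d : measure_display} {T : measurableType d} {R : realType}
    (mu : {measure set T -> \bar R}) (f : T -> R) (K delta : R) :
  mu setT = 1%E -> bounded_ge0 f -> 0 < expect mu f -> 0 < delta ->
  expect mu (fun x => f x ^+ 2) <= K * expect mu f ^+ 2 ->
  (mu [set x | (delta * expect mu f <= `|f x - expect mu f|)%R] <=
    ((K - 1) / delta ^+ 2)%:E)%E.
Proof.
move=> mu1 bf; set M := expect mu f => M0 d0 H.
set A := [set x | _].
have mf : measurable_fun setT f by case: bf.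
have mA : measurable A.
  rewrite -[A]setTI (_ : A = (fun x => delta * M <= `|f x - M|) @^-1` [set true]).
    apply: measurable_fun_ler => //.
    apply: (@measurableT_comp _ _ _ _ _ _ (fun x : R => `|x|)) => //.
    exact: measurable_funB.
  by apply/seteqP; split.
have bA : bounded_ge0 (\1_A : T -> R).
  split; first exact: measurable_indic.
    by move=> x; rewrite indicE.
  by exists 1 => x; rewrite indicE; case: (_ \in _).
have bf2 : bounded_ge0 (fun x => f x ^+ 2) := bounded_ge0M bf bf.
have dM0 : 0 <= (delta * M) ^+ 2 by exact: sqr_ge0.
(* This integrates (delta M)^2 1_A <= (f - M)^2 with the cross term moved to the left, so that both
   integrands stay nonnegative. *)
have : expect mu (fun x => 2 * M * f x + (delta * M) ^+ 2 * \1_A x) <=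
       expect mu (fun x => f x ^+ 2 + M ^+ 2).
  apply: le_expect => //.
  - apply: bounded_ge0D; apply: bounded_ge0Z => //; lra.
  - by apply: bounded_ge0D => //; apply: bounded_ge0_cst; exact: sqr_ge0.
  - move=> x; have [xA|xA] := boolP (x \in A); rewrite indicE ?xA ?(negbTE xA).
      have : (delta * M) ^+ 2 <= `|f x - M| ^+ 2.
        have dM : 0 <= delta * M by rewrite mulr_ge0// ltW.
        by rewrite lerXn2r ?nnegrE//; exact: (set_mem xA).
      rewrite real_normK ?num_real// => H1; rewrite mulr1 -subr_ge0.
      rewrite -subr_ge0 in H1; apply: le_trans H1 _; rewrite le_eqVlt.
      by apply/orP; left; apply/eqP; ring.
    rewrite mulr0 addr0 -subr_ge0; apply: le_trans (sqr_ge0 (f x - M)) _.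
    by rewrite le_eqVlt; apply/orP; left; apply/eqP; ring.
rewrite expectD//; last 2 first.
- by apply: bounded_ge0Z => //; lra.
- exact: bounded_ge0Z.
rewrite expectD//; last by apply: bounded_ge0_cst; exact: sqr_ge0.
have M20 : 0 <= 2 * M by lra.
rewrite (expectZ mu1 M20 bf) (expectZ mu1 dM0 bA) expect_cst// -/M => H1.
rewrite -expect_indic// lee_fin ler_pdivlMr ?exprn_gt0//.
rewrite -(ler_pM2r (exprn_gt0 2 M0)).
by lra.
Qed.

(** * Mean of the hard-core partition function *)

Section repulsive_process.
Context {dT : measure_display} {T : measurableType dT} {R : realType} {q : nat}.
Variables (e : rel (T * 'I_q)) (lam : 'I_q -> R).
Hypothesis lam_ge0 : forall a, 0 <= lam a.
Hypothesis measurable_e : forall a b,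
  measurable_fun setT (fun p : T * T => e (p.1, a) (p.2, b)).

(** * Measurability in the positions of the points *)

Section measurability.
Context {dS : measure_display} {S : measurableType dS}.

(** Vertices carry symbolic indices, evaluated at x only here: the list of indices does not depend
    on x, which allows induction on it. *)
Let at_ {I : Type} (F : I -> S -> T) (x : S) (v : I * 'I_q) : T * 'I_q :=
  (F v.1 x, v.2).

Lemma bounded_ge0_compat {I : Type} (F : I -> S -> T) v eta :
  (forall i, measurable_fun setT (F i)) ->
  bounded_ge0 (fun x => (~~ has (e (at_ F x v)) (map (at_ F x) eta))%:R : R).
Proof.
move=> mF; elim: eta => [|u eta IH] /=; first exact: bounded_ge0_cst.
have := bounded_ge0M (f := fun x => (~~ e (at_ F x v) (at_ F x u))%:R) _ IH.
rewrite (_ : (fun x => _ * _) = (fun x =>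
  (~~ (e (at_ F x v) (at_ F x u) || has (e (at_ F x v)) (map (at_ F x) eta)))%:R));
  last first.
  by apply/funext => x; case: (e _ _) => /=; rewrite ?mul0r ?mul1r.
apply; apply: bounded_ge0_bool.
apply: measurable_neg; exact: (measurableT_comp (measurable_e v.2 u.2)
  (measurable_fun_pair (mF v.1) (mF u.1))).
Qed.

Lemma bounded_ge0_hc {I : Type} (F : I -> S -> T) (c : R) s eta : 0 <= c ->
  (forall i, measurable_fun setT (F i)) ->
  bounded_ge0 (fun x => hc e (fun v => c * lam v.2)
    (map (at_ F x) s) (map (at_ F x) eta)).
Proof.
move=> c0 mF; elim: s eta => [|v s IH] eta /=; first exact: bounded_ge0_cst.
apply: bounded_ge0D => //; apply: bounded_ge0M; first exact: bounded_ge0_compat.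
apply: bounded_ge0Z; first by rewrite mulr_ge0.
exact: (IH (v :: eta)).
Qed.

Lemma bounded_ge0_full_weight {I : Type} (F : I -> S -> T) s eta :
  (forall i, measurable_fun setT (F i)) ->
  bounded_ge0 (fun x => full_weight e lam (map (F^~ x) s) (map (at_ F x) eta)).
Proof.
move=> mF; elim: s eta => [|i s IH] eta /=; first exact: bounded_ge0_cst.
apply: bounded_ge0_sum => a; apply: bounded_ge0M.
  exact: (bounded_ge0_compat (i, a)).
by apply: bounded_ge0Z => //; exact: (IH ((i, a) :: eta)).
Qed.

Variables (n : nat) (g : S -> n.-tuple T) (h : S -> T).
Hypotheses (mg : measurable_fun setT g) (mh : measurable_fun setT h).

(** Points have three sources: constants from the boundary condition, one extra random point, and
    the coordinates of a random tuple. *)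
Let F (i : T + unit + 'I_n) : S -> T :=
  match i with
  | inl (inl y) => fun=> y
  | inl (inr _) => h
  | inr i => fun x => tnth (g x) i
  end.

Let mF i : measurable_fun setT (F i).
Proof.
case: i => [[y|_]|i] //=.
exact: (measurableT_comp (@measurable_tnth _ T n i) mg).
Qed.

Let gE x : g x = [seq F (inr i) x | i <- enum 'I_n] :> seq T.
Proof. by rewrite -[in LHS](map_tnth_enum (g x)). Qed.

Let etaE x eta : eta = map (at_ F x) [seq (inl (inl v.1), v.2) | v <- eta].
Proof. by rewrite -map_comp -[LHS]map_id; apply: eq_map => -[]. Qed.

Let vertE x : vertices (g x) =
  map (at_ F x) [seq (inr i, a) | i <- enum 'I_n, a <- enum 'I_q].
Proof.
rewrite /vertices gE.
elim: (enum 'I_n) => [|i s IH] //=.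
by rewrite map_cat; congr (_ ++ _); [rewrite -map_comp|exact: IH].
Qed.

Lemma bounded_ge0_hc_tuple c eta : 0 <= c ->
  bounded_ge0 (fun x => hc e (fun v => c * lam v.2) (vertices (g x)) eta).
Proof.
move=> c0; apply: eq_bounded_ge0 (bounded_ge0_hc
  [seq (inr i, a) | i <- enum 'I_n, a <- enum 'I_q]
  [seq (inl (inl v.1), v.2) | v <- eta] c0 mF) => x.
by rewrite -vertE -etaE.
Qed.

Lemma bounded_ge0_hc_tuple_cons c a eta : 0 <= c ->
  bounded_ge0 (fun x =>
    hc e (fun v => c * lam v.2) (vertices (g x)) ((h x, a) :: eta)).
Proof.
move=> c0; apply: eq_bounded_ge0 (bounded_ge0_hc
  [seq (inr i, a) | i <- enum 'I_n, a <- enum 'I_q]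
  ((inl (inr tt), a) :: [seq (inl (inl v.1), v.2) | v <- eta]) c0 mF) => x.
by rewrite map_cons -vertE -etaE.
Qed.

Lemma bounded_ge0_full_weight_tuple eta :
  bounded_ge0 (fun x => full_weight e lam (g x) eta).
Proof.
apply: eq_bounded_ge0 (bounded_ge0_full_weight
  [seq inr i | i <- enum 'I_n] [seq (inl (inl v.1), v.2) | v <- eta] mF) => x.
by rewrite -map_comp -etaE gE.
Qed.

Lemma bounded_ge0_full_weight_tuple_cons a eta :
  bounded_ge0 (fun x => full_weight e lam (g x) ((h x, a) :: eta)).
Proof.
apply: eq_bounded_ge0 (bounded_ge0_full_weight
  [seq inr i | i <- enum 'I_n]
  ((inl (inr tt), a) :: [seq (inl (inl v.1), v.2) | v <- eta]) mF) => x.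
by rewrite map_cons -map_comp -etaE gE.
Qed.

Lemma bounded_ge0_compat_tuple a eta :
  bounded_ge0 (fun x => (~~ has (e (h x, a)) eta)%:R : R).
Proof.
apply: eq_bounded_ge0 (bounded_ge0_compat (inl (inr tt), a)
  [seq (inl (inl v.1), v.2) | v <- eta] mF) => x.
by rewrite -etaE.
Qed.

End measurability.

Variable mu : {sigma_finite_measure set T -> \bar R}.
Hypothesis mu1 : mu setT = 1%E.

Definition regular_in_eta (F : seq (T * 'I_q) -> R) : Prop :=
  forall a eta, bounded_ge0 (fun x => F ((x, a) :: eta)).

(** A transfer operator: iterating it on the constant 1 yields [mean_weight]. *)
Definition one_more (F : seq (T * 'I_q) -> R) (eta : seq (T * 'I_q)) : R :=
  expect mu (fun x =>
    \sum_a (~~ has (e (x, a)) eta)%:R * (lam a * F ((x, a) :: eta))).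

Lemma bounded_ge0_one_more F eta : regular_in_eta F ->
  bounded_ge0 (fun x =>
    \sum_a (~~ has (e (x, a)) eta)%:R * (lam a * F ((x, a) :: eta))).
Proof.
move=> rF; apply: bounded_ge0_sum => a; apply: bounded_ge0M.
  exact: (bounded_ge0_compat_tuple (n := 0) (g := fun=> [tuple]) (h := id)).
exact: bounded_ge0Z.
Qed.

Lemma le_one_more F G eta : regular_in_eta F -> regular_in_eta G ->
  (forall eta', F eta' <= G eta') -> one_more F eta <= one_more G eta.
Proof.
move=> rF rG FG; apply: le_expect => //; [exact: bounded_ge0_one_more..|].
by move=> x; apply: ler_sum => a _; rewrite !ler_wpM2l.
Qed.

Lemma one_more_sum n (c : 'I_n -> R) (F : 'I_n -> seq (T * 'I_q) -> R) eta :
  (forall i, 0 <= c i) -> (forall i, regular_in_eta (F i)) ->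
  one_more (fun eta' => \sum_i c i * F i eta') eta =
  \sum_i c i * one_more (F i) eta.
Proof.
move=> c0 rF; rewrite /one_more.
under [RHS]eq_bigr => i _ do
  rewrite -(expectZ mu1 (c0 i) (bounded_ge0_one_more eta (rF i))).
rewrite -expect_sum//; last first.
  by move=> i; apply: bounded_ge0Z => //; exact: bounded_ge0_one_more.
congr expect; apply/funext => x.
under [RHS]eq_bigr do rewrite big_distrr.
rewrite exchange_big /=; apply: eq_bigr => a _.
rewrite !big_distrr /=; apply: eq_bigr => i _.
by ring.
Qed.

Lemma one_moreZ c F eta : 0 <= c -> regular_in_eta F ->
  one_more (fun eta' => c * F eta') eta = c * one_more F eta.
Proof.
move=> c0 rF; rewrite -(expectZ mu1 c0 (bounded_ge0_one_more eta rF)).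
congr expect; apply/funext => x; rewrite big_distrr /=.
by apply: eq_bigr => a _; ring.
Qed.

Lemma one_more_ge0 F eta : (forall eta', 0 <= F eta') -> 0 <= one_more F eta.
Proof.
move=> F0; apply: expect_ge0 => x; apply: sumr_ge0 => a _.
by rewrite !mulr_ge0.
Qed.

Definition mean_weight n eta : R :=
  expect (mpower mu n) (fun t => full_weight e lam t eta).

Lemma mean_weight_ge0 n eta : 0 <= mean_weight n eta.
Proof. by apply: expect_ge0 => t; exact: full_weight_ge0. Qed.

Lemma bounded_ge0_full_weightT n eta :
  bounded_ge0 (fun t : n.-tuple T => full_weight e lam t eta).
Proof. exact: (bounded_ge0_full_weight_tuple (g := id) (h := fun=> point)). Qed.

Lemma regular_mean_weight n : regular_in_eta (mean_weight n).
Proof.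
move=> a eta; apply: (@bounded_ge0_expect _ _ _ _ _ (mpower mu n)
  (fun x t => full_weight e lam t ((x, a) :: eta))); first exact: mpowerT.
exact: (bounded_ge0_full_weight_tuple_cons (g := snd) (h := fst)).
Qed.

Lemma mean_weight0 eta : mean_weight 0 eta = 1.
Proof.
rewrite -[RHS](expect_cst (mpowerT 0 mu1)); congr expect.
by apply/funext => t; rewrite tuple0.
Qed.

Lemma mean_weightS n eta :
  mean_weight n.+1 eta = one_more (mean_weight n) eta.
Proof.
rewrite /mean_weight expect_mpowerS//; last exact: bounded_ge0_full_weightT.
congr expect; apply/funext => x /=.
have bw a : bounded_ge0 (fun t : n.-tuple T =>
    lam a * full_weight e lam t ((x, a) :: eta)).
  by apply: bounded_ge0Z => //; exact: bounded_ge0_full_weightT.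
have mun1 := mpowerT n mu1.
rewrite expect_sum//; last by move=> a; exact: bounded_ge0Z.
apply: eq_bigr => a _; rewrite expectZ// expectZ//.
exact: bounded_ge0_full_weightT.
Qed.

(* Dropping the constraints of the last particle. *)
Lemma mean_weightS_le n eta :
  mean_weight n.+1 eta <= (\sum_a lam a) * mean_weight n eta.
Proof.
have mun1 := mpowerT n mu1.
rewrite mean_weightS -[leRHS](expect_cst mu1).
apply: le_expect => //; first exact: bounded_ge0_one_more (@regular_mean_weight n).
  apply: bounded_ge0_cst; rewrite mulr_ge0 ?mean_weight_ge0//.
  exact: sumr_ge0.
move=> x; rewrite big_distrl /=; apply: ler_sum => a _.
rewrite -[leRHS]mul1r; apply: ler_pM => //.
- by rewrite mulr_ge0// mean_weight_ge0.
- by case: has; rewrite ?ler01 ?lexx.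
rewrite ler_wpM2l//; apply: le_expect => //; [exact: bounded_ge0_full_weightT..|].
by move=> t; apply: (full_weight_anti lam_ge0) => v /= ->; rewrite orbT.
Qed.

(** * Recursion for the mean in the number of points *)

Section mean_hard_core.
Variable c : R.
Hypothesis c_ge0 : 0 <= c.
Let w (v : T * 'I_q) := c * lam v.2.
Let w_ge0 v : 0 <= w v. Proof. by rewrite mulr_ge0. Qed.

Definition mean_hc n eta : R :=
  expect (mpower mu n) (fun t => hc e w (vertices t) eta).

Lemma bounded_ge0_hcT n eta :
  bounded_ge0 (fun t : n.-tuple T => hc e w (vertices t) eta).
Proof. exact: (bounded_ge0_hc_tuple (g := id) (h := fun=> point)). Qed.

Lemma regular_mean_hc n : regular_in_eta (mean_hc n).
Proof.
move=> a eta; apply: (@bounded_ge0_expect _ _ _ _ _ (mpower mu n)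
  (fun x t => hc e w (vertices t) ((x, a) :: eta))); first exact: mpowerT.
exact: (bounded_ge0_hc_tuple_cons (g := snd) (h := fst)).
Qed.

Lemma mean_hc0 eta : mean_hc 0 eta = 1.
Proof.
rewrite -[RHS](expect_cst (mpowerT 0 mu1)); congr expect.
by apply/funext => t; rewrite tuple0.
Qed.

Lemma mean_hc_ge0 n eta : 0 <= mean_hc n eta.
Proof. by apply: expect_ge0 => t; exact: hc_ge0. Qed.

Lemma vertices_tcons n (x : T) (t : n.-tuple T) :
  vertices (tcons (x, t)) = [seq (x, a) | a <- enum 'I_q] ++ vertices t.
Proof. by []. Qed.

Lemma big_block (idx : R) (op : Monoid.com_law idx) (x : T) (F : T * 'I_q -> R) :
  \big[op/idx]_(v <- [seq (x, a) | a <- enum 'I_q]) F v = \big[op/idx]_a F (x, a).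
Proof. by rewrite big_map big_enum. Qed.

Lemma bounded_ge0_single_occupancy n x eta : bounded_ge0 (fun t : n.-tuple T =>
  single_occupancy e w [seq (x, a) | a <- enum 'I_q] (vertices t) eta).
Proof.
apply: bounded_ge0_sum => v; apply: bounded_ge0Z => //.
by apply: bounded_ge0Z => //; exact: bounded_ge0_hcT.
Qed.

Lemma expect_single_occupancy n x eta :
  expect (mpower mu n) (fun t =>
    single_occupancy e w [seq (x, a) | a <- enum 'I_q] (vertices t) eta) =
  c * \sum_a (~~ has (e (x, a)) eta)%:R * (lam a * mean_hc n ((x, a) :: eta)).
Proof.
have mun1 := mpowerT n mu1.
have bh v : bounded_ge0 (fun t : n.-tuple T =>
    w v * hc e w (vertices t) (v :: eta)).
  by apply: bounded_ge0Z => //; exact: bounded_ge0_hcT.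
rewrite /single_occupancy expect_sum//; last first.
  by move=> v; exact: bounded_ge0Z.
rewrite big_block big_distrr /=; apply: eq_bigr => a _.
rewrite expectZ// expectZ//; last exact: bounded_ge0_hcT.
by rewrite /w /mean_hc /=; ring.
Qed.

Let bounded_ge0_hc_cons n eta :
  bounded_ge0 (fun p : T * n.-tuple T => hc e w (vertices (tcons p)) eta).
Proof.
exact: (bounded_ge0_comp (@measurable_tcons _ _ n) (@bounded_ge0_hcT n.+1 eta)).
Qed.

Let bounded_ge0_mean_hc_cons n eta : bounded_ge0 (fun x : T =>
  expect (mpower mu n) (fun t => hc e w (vertices (tcons (x, t))) eta)).
Proof.
apply: (@bounded_ge0_expect _ _ _ _ _ (mpower mu n)
  (fun x t => hc e w (vertices (tcons (x, t))) eta)); first exact: mpowerT.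
by apply: eq_bounded_ge0 (bounded_ge0_hc_cons n eta) => -[].
Qed.

Let bounded_ge0_hc_consx n x eta :
  bounded_ge0 (fun t : n.-tuple T => hc e w (vertices (tcons (x, t))) eta).
Proof.
exact: (bounded_ge0_comp (measurable_pair1 x) (bounded_ge0_hc_cons n eta)).
Qed.

Lemma mean_hcS_ge n eta :
  mean_hc n eta + c * one_more (mean_hc n) eta <= mean_hc n.+1 eta.
Proof.
have mun1 := mpowerT n mu1.
have bo := bounded_ge0_one_more eta (@regular_mean_hc n).
have bm : bounded_ge0 (fun _ : T => mean_hc n eta).
  by apply: bounded_ge0_cst; exact: mean_hc_ge0.
rewrite [leRHS]expect_mpowerS//; last exact: bounded_ge0_hcT.
rewrite -[X in X + _](expect_cst mu1) -(expectZ mu1 c_ge0 bo) -expectD//; last first.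
  exact: bounded_ge0Z.
apply: le_expect => //; first by apply: bounded_ge0D => //; exact: bounded_ge0Z.
move=> x; rewrite -expect_single_occupancy -expectD//; last 2 first.
- exact: bounded_ge0_hcT.
- exact: bounded_ge0_single_occupancy.
apply: le_expect => //.
  apply: bounded_ge0D; first exact: bounded_ge0_hcT.
  exact: bounded_ge0_single_occupancy.
by move=> t; rewrite vertices_tcons; exact: hc_cat_lower.
Qed.

(** The part of the product of second and higher order: the unconstrained weight of at least two
    particles at the same point. *)
Definition multi_occupancy : R :=
  \prod_a (1 + c * lam a) - \sum_a c * lam a - 1.

Lemma multi_occupancy_ge0 : 0 <= multi_occupancy.
Proof.
rewrite /multi_occupancy subr_ge0 -[\prod_a _]big_enum -[\sum_a _]big_enum /=.
elim: (enum _) => [|a s IH]; first by rewrite !big_nil subr0.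
rewrite !big_cons; set p := \prod_(_ <- _) _ in IH *.
set S := \sum_(_ <- _) _ in IH *.
have S0 : 0 <= S by apply: sumr_ge0 => b _; exact: mulr_ge0.
have : 0 <= c * lam a * (p - 1) by rewrite !mulr_ge0//; lra.
by lra.
Qed.

Lemma mean_hcS_le n eta :
  mean_hc n.+1 eta <=
    (1 + multi_occupancy) * mean_hc n eta + c * one_more (mean_hc n) eta.
Proof.
have mun1 := mpowerT n mu1.
have r0 : 0 <= 1 + multi_occupancy by rewrite addr_ge0// multi_occupancy_ge0.
have bo := bounded_ge0_one_more eta (@regular_mean_hc n).
have bm : bounded_ge0 (fun _ : T => (1 + multi_occupancy) * mean_hc n eta).
  by apply: bounded_ge0_cst; rewrite mulr_ge0// mean_hc_ge0.
rewrite [leLHS]expect_mpowerS//; last exact: bounded_ge0_hcT.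
rewrite -[X in X + _](expect_cst mu1) -(expectZ mu1 c_ge0 bo) -expectD//; last first.
  exact: bounded_ge0Z.
apply: le_expect => //; first by apply: bounded_ge0D => //; exact: bounded_ge0Z.
move=> x; rewrite -expect_single_occupancy -expectZ//; last first.
  exact: bounded_ge0_hcT.
have bh : bounded_ge0 (fun t : n.-tuple T =>
    (1 + multi_occupancy) * hc e w (vertices t) eta).
  by apply: bounded_ge0Z => //; exact: bounded_ge0_hcT.
rewrite -expectD//; last exact: bounded_ge0_single_occupancy.
apply: le_expect => //.
  by apply: bounded_ge0D => //; exact: bounded_ge0_single_occupancy.
move=> t; rewrite vertices_tcons; apply: le_trans (hc_cat_upper _ _ _ _ _) _ => //.
by rewrite !big_block lerD2r /multi_occupancy addrCA subrr addr0.
Qed.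

(** Exact solution of the recursion in which a point holds at most one particle; k counts the
    occupied points. *)
Definition binomial_mean n eta : R :=
  \sum_(k < n.+1) 'C(n, k)%:R * c ^+ k * mean_weight k eta.

Let coef_ge0 n k : 0 <= 'C(n, k)%:R * c ^+ k :> R.
Proof. by rewrite mulr_ge0// exprn_ge0. Qed.

Lemma regular_binomial_mean n : regular_in_eta (binomial_mean n).
Proof.
move=> a eta; apply: bounded_ge0_sum => k; apply: bounded_ge0Z => //.
exact: regular_mean_weight.
Qed.

Lemma binomial_meanS n eta :
  binomial_mean n.+1 eta =
    binomial_mean n eta + c * one_more (binomial_mean n) eta.
Proof.
rewrite /binomial_mean one_more_sum//; last first.
  by move=> k; exact: regular_mean_weight.
rewrite big_ord_recl [in X in _ = X + _]big_ord_recl !bin0 -addrA; congr (_ + _).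
rewrite big_distrr /=.
under [X in _ = _ + X]eq_bigr => k _ do rewrite -mean_weightS.
under eq_bigr => k _ do rewrite /bump add1n binS natrD !mulrDl.
(* The extra top term of the first sum vanishes because n choose n + 1 is 0. *)
rewrite big_split /= big_ord_recr /= bin_small// !mul0r addr0; congr (_ + _).
by apply: eq_bigr => k _; rewrite exprS; ring.
Qed.

Lemma mean_hc_ge n eta : binomial_mean n eta <= mean_hc n eta.
Proof.
elim: n eta => [|n IH] eta.
  by rewrite mean_hc0 /binomial_mean big_ord1 bin0 expr0 !mul1r mean_weight0.
apply: le_trans (mean_hcS_ge n eta); rewrite binomial_meanS lerD//.
rewrite ler_wpM2l//; apply: le_one_more => //.
  exact: regular_binomial_mean.
exact: regular_mean_hc.
Qed.

(** Each revealed point costs one factor [1 + multi_occupancy]; linearity and monotonicity of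
    [one_more] carry the accumulated factor through the other term. *)
Lemma mean_hc_le n eta :
  mean_hc n eta <= (1 + multi_occupancy) ^+ n * binomial_mean n eta.
Proof.
have r0 := multi_occupancy_ge0.
have r1 : 0 <= 1 + multi_occupancy by rewrite addr_ge0.
have rn k : 0 <= (1 + multi_occupancy) ^+ k by rewrite exprn_ge0.
elim: n eta => [|n IH] eta.
  by rewrite mean_hc0 /binomial_mean big_ord1 bin0 !expr0 !mul1r mean_weight0.
apply: le_trans (mean_hcS_le n eta) _; rewrite binomial_meanS mulrDr.
have o0 : 0 <= one_more (binomial_mean n) eta.
  apply: one_more_ge0 => eta'; apply: sumr_ge0 => k _.
  by rewrite mulr_ge0// mean_weight_ge0.
apply: lerD.
  by rewrite exprS -mulrA ler_wpM2l.
rewrite mulrCA ler_wpM2l//.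
apply: (@le_trans _ _ ((1 + multi_occupancy) ^+ n * one_more (binomial_mean n) eta)).
  rewrite -one_moreZ//; last exact: regular_binomial_mean.
  apply: le_one_more => //; first exact: regular_mean_hc.
  by move=> a eta'; apply: bounded_ge0Z => //; exact: regular_binomial_mean.
by rewrite ler_wpM2r// exprS ler_peMl// lerDl.
Qed.

Lemma bounded_influence_hc n eta :
  bounded_influence (\prod_a (1 + c * lam a) - 1)
    (fun t : n.-tuple T => hc e w (vertices t) eta).
Proof.
elim: n eta => [|n IH] eta //=; split.
  move=> x.
  (* A section at x still contains the fixed block over x. Expanding that block enlarges [eta], so
     the induction hypothesis is needed for every [eta]. *)
  have H s : bounded_influence (\prod_a (1 + c * lam a) - 1)
      (fun t : n.-tuple T => hc e w (s ++ vertices t) eta).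
    elim: s eta => [|v s IHs] eta' /=; first exact: IH.
    apply: bounded_influenceD; first exact: IHs.
    by do 2 apply: bounded_influenceZ => //.
  exact: H.
exists (fun t => hc e w (vertices t) eta); split; first exact: bounded_ge0_hcT.
move=> x t; rewrite vertices_tcons hc_cat_ge//= addrC subrK.
by apply: le_trans (hc_cat_le _ _ _ _ _) _ => //; rewrite big_map big_enum.
Qed.

End mean_hard_core.

End repulsive_process.

(** * Series and exponential estimates *)

Lemma big_ffun_ordS {R : Type} {idx : R} (op : Monoid.com_law idx) k
    (I : finType) (F : {ffun 'I_k.+1 -> I} -> R) :
  \big[op/idx]_tau F tau =
  \big[op/idx]_a \big[op/idx]_(sigma : {ffun 'I_k -> I})
    F [ffun i => if unlift ord0 i is Some j then sigma j else a].
Proof.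
rewrite pair_big /=.
rewrite (reindex (fun p : I * {ffun 'I_k -> I} => [ffun i =>
  if unlift ord0 i is Some j then p.2 j else p.1]))//=.
exists (fun tau => (tau ord0, [ffun j => tau (lift ord0 j)])).
  move=> [a sigma] _; congr pair; first by rewrite ffunE unlift_none.
  by apply/ffunP => j; rewrite !ffunE liftK.
move=> tau _; apply/ffunP => i; rewrite ffunE.
by case: unliftP => [j|] -> //=; rewrite ffunE.
Qed.

(** Particles are tested against those placed earlier, which fixes the orientation of [e] for i <
    j. *)
Lemma full_weightE {T : Type} {R : realType} {q : nat} (e : rel (T * 'I_q))
    (lam : 'I_q -> R) k (x : k.-tuple T) eta :
  full_weight e lam x eta = \sum_(tau : {ffun 'I_k -> 'I_q})
    (\prod_(i < k) lam (tau i)) * ((\prod_(i < k) (~~ has (e (tnth x i, tau i)) eta)%:R) *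
    \prod_(i < k) \prod_(j < k | (i < j)%N)
      (~~ e (tnth x j, tau j) (tnth x i, tau i))%:R).
Proof.
elim: k x eta => [|k IH] x eta.
  rewrite tuple0 /= (big_pred1 (ffun0 (card_ord 0))); last first.
    by move=> tau; apply/esym/eqP/ffunP => -[].
  by rewrite !big_ord0 !mulr1.
case/tupleP: x => x t /=; rewrite big_ffun_ordS; apply: eq_bigr => a _.
rewrite IH !big_distrr /=; apply: eq_bigr => sigma _.
set tau := [ffun i => _].
have tau0 : tau ord0 = a by rewrite ffunE unlift_none.
have tauS i : tau (lift ord0 i) = sigma i by rewrite ffunE liftK.
pose w i := (tnth [tuple of x :: t] i, tau i).
have w0 : w ord0 = (x, a) by rewrite /w tau0.
have wS i : w (lift ord0 i) = (tnth t i, sigma i) by rewrite /w tauS tnthS.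
rewrite -[RHS]/(_ * (\prod_(i < k.+1) (~~ has (e (w i)) eta)%:R *
  \prod_(i < k.+1) \prod_(j < k.+1 | (i < j)%N) (~~ e (w j) (w i))%:R)).
have -> : \prod_i lam (tau i) = lam a * \prod_i lam (sigma i).
  by rewrite big_ord_recl tau0; congr (_ * _); apply: eq_bigr => i _; rewrite tauS.
have -> : \prod_(i < k.+1) (~~ has (e (w i)) eta)%:R = (~~ has (e (x, a)) eta)%:R *
    \prod_i (~~ has (e (tnth t i, sigma i)) eta)%:R :> R.
  by rewrite big_ord_recl w0; congr (_ * _); apply: eq_bigr => i _; rewrite wS.
have -> : \prod_(i < k.+1) \prod_(j < k.+1 | (i < j)%N) (~~ e (w j) (w i))%:R =
    \prod_i (~~ e (tnth t i, sigma i) (x, a))%:R *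
    \prod_(i < k) \prod_(j < k | (i < j)%N)
      (~~ e (tnth t j, sigma j) (tnth t i, sigma i))%:R :> R.
  rewrite big_ord_recl; congr (_ * _).
    rewrite big_mkcond big_ord_recl /= mul1r; apply: eq_bigr => i _.
    by rewrite w0 wS.
  apply: eq_bigr => i _; rewrite big_mkcond big_ord_recl /= mul1r.
  rewrite [RHS]big_mkcond; apply: eq_bigr => j _.
  by rewrite !wS /bump !add1n ltnS.
rewrite (_ : \prod_i (~~ has (e (tnth t i, sigma i)) ((x, a) :: eta))%:R =
  \prod_i (~~ e (tnth t i, sigma i) (x, a))%:R *
  \prod_i (~~ has (e (tnth t i, sigma i)) eta)%:R); last first.
  rewrite -big_split /=; apply: eq_bigr => i _.
  by rewrite /= negb_or -mulnb natrM.
by ring.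
Qed.

Section poisson_domination.
Context {R : realFieldType}.
Variables (T : nat -> R) (s : R).
Hypotheses (T_ge0 : forall k, 0 <= T k) (s_ge0 : 0 <= s).
Hypothesis TS : forall k, k.+1%:R * T k.+1 <= s * T k.

Lemma ffact_ratio_le1 n k : (n ^_ k)%:R / n%:R ^+ k <= 1 :> R.
Proof.
elim: k => [|k IH]; first by rewrite ffactn0 expr0 divr1.
rewrite ffactnSr exprSr natrM invfM mulrACA -[leRHS]mul1r.
apply: ler_pM => //; rewrite ?divr_ge0 ?exprn_ge0//.
case: n {IH} => [|n]; first by rewrite sub0n mul0r ler01.
by rewrite ler_pdivrMr ?ltr0n// mul1r ler_nat leq_subr.
Qed.

(* [n ^_ k / n ^ k] is the probability that [k] uniform choices among [n]
   points are distinct; this is the union bound. *)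
Lemma ffact_ratio_ge n k : (0 < n)%N ->
  1 - 'C(k, 2)%:R / n%:R <= (n ^_ k)%:R / n%:R ^+ k :> R.
Proof.
move=> n0; have n0' : 0 < n%:R :> R by rewrite ltr0n.
elim: k => [|k IH]; first by rewrite ffactn0 expr0 divr1 mul0r subr0.
rewrite ffactnSr exprSr natrM invfM mulrACA binS bin1 natrD.
have := ffact_ratio_le1 n k.
set c := (n ^_ k)%:R / _ in IH *; move=> c1.
have c0 : 0 <= c by rewrite divr_ge0// exprn_ge0.
apply: (@le_trans _ _ (c * (1 - k%:R / n%:R))).
  apply: (@le_trans _ _ (c - k%:R / n%:R)).
    by rewrite mulrDl; lra.
  by rewrite mulrBr mulr1 lerD2l lerN2 ler_piMl// divr_ge0.
rewrite ler_wpM2l// ler_pdivlMr// mulrBl mul1r divfK ?lt0r_neq0//.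
by rewrite lerBlDr -natrD ler_nat addnC -maxnE leq_maxr.
Qed.

(** For Poisson weights s^k / k! the mean of k choose 2 is s^2 / 2. Two applications of [TS] give
    the same bound termwise after a shift of k by 2. *)
Lemma sum_bin2_le N : \sum_(k < N) 'C(k, 2)%:R * T k <= s ^+ 2 / 2 * \sum_(k < N) T k.
Proof.
have H k : 'C(k.+2, 2)%:R * T k.+2 <= s ^+ 2 / 2 * T k.
  have E : 2 * 'C(k.+2, 2)%:R = k.+2%:R * k.+1%:R :> R.
    by have := mul_bin_diag k.+2 1; rewrite /= bin1 => E; rewrite -!natrM E.
  rewrite -(ler_pM2l (ltr0Sn R 1)) mulrA E.
  rewrite [leRHS](_ : _ = s * (s * T k)); last by field.
  apply: (@le_trans _ _ (s * (k.+1%:R * T k.+1))); last by rewrite ler_wpM2l.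
  rewrite mulrCA [k.+2%:R * _]mulrC -mulrA.
  by rewrite ler_wpM2l.
have s2 : 0 <= s ^+ 2 / 2 by rewrite divr_ge0// sqr_ge0.
case: N => [|[|N]]; first by rewrite !big_ord0 mulr0.
  by rewrite !big_ord1 mul0r mulr_ge0.
rewrite 2!big_ord_recl !mul0r !add0r.
apply: (@le_trans _ _ (s ^+ 2 / 2 * \sum_(k < N) T k)).
  by rewrite big_distrr /=; apply: ler_sum => k _; exact: H.
by rewrite ler_wpM2l// 2!big_ord_recr /= -addrA lerDl addr_ge0.
Qed.

(** With T k = V^k u_k / k! this is the binomial mean, since (n choose k) k! = n ^_ k. *)
Definition thinned_sum n : R := \sum_(k < n.+1) (n ^_ k)%:R / n%:R ^+ k * T k.

Lemma thinned_sum_le n : thinned_sum n <= \sum_(k < n.+1) T k.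
Proof.
by apply: ler_sum => k _; rewrite -[leRHS]mul1r ler_wpM2r// ffact_ratio_le1.
Qed.

(** N is independent of n: one bound for all partial sums also yields finiteness of the series. *)
Lemma thinned_sum_ge n N : (0 < n)%N ->
  (1 - s ^+ 2 / (2 * n%:R)) * \sum_(k < N) T k <= thinned_sum n.
Proof.
move=> n0; have n0' : 0 < n%:R :> R by rewrite ltr0n.
have c0 k : 0 <= (n ^_ k)%:R / n%:R ^+ k * T k.
  by rewrite mulr_ge0// divr_ge0// exprn_ge0.
apply: (@le_trans _ _ (\sum_(k < N) (n ^_ k)%:R / n%:R ^+ k * T k)).
  apply: (@le_trans _ _ (\sum_(k < N) (1 - 'C(k, 2)%:R / n%:R) * T k)).
    under [leRHS]eq_bigr do rewrite mulrBl mul1r mulrAC.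
    rewrite sumrB -big_distrl /= mulrBl mul1r lerD2l lerN2.
    rewrite ler_pdivrMr//; apply: le_trans (sum_bin2_le N) _.
    by rewrite le_eqVlt; apply/orP; left; apply/eqP; field; rewrite lt0r_neq0.
  by apply: ler_sum => k _; rewrite ler_wpM2r// ffact_ratio_ge.
rewrite /thinned_sum -!(big_mkord xpredT (fun k => (n ^_ k)%:R / n%:R ^+ k * T k)).
(* If N exceeds n + 1, the additional terms vanish because n ^_ k = 0 for k > n. *)
have [Nn|nN] := leqP N n.+1.
  by rewrite [leRHS](big_cat_nat (leq0n N) Nn)/= lerDl sumr_ge0.
rewrite (big_cat_nat (leq0n _) (ltnW nN))/= gerDl big_nat big1// => k /andP[nk _].
by rewrite ffact_small// !mul0r.
Qed.

End poisson_domination.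

Section exponential_estimates.
Context {R : realType}.

(** From exp(-x) >= 1 - x one gets exp(x) <= 1 / (1 - x), and (1 - x)(1 + x + 2 x^2) = 1 + x^2 (1 -
    2 x). *)
Lemma expR_le_quadratic (x : R) : 0 <= x <= 2^-1 ->
  expR x <= 1 + x + 2 * x ^+ 2.
Proof.
move=> /andP[x0 x2].
have e0 : 0 < 1 - x by lra.
have : expR x * (1 - x) <= 1.
  have := expR_ge1Dx (- x); rewrite -(ler_pM2l (expR_gt0 x)) -expRD subrr expR0.
  by [].
rewrite -ler_pdivlMr// => /le_trans; apply; rewrite ler_pdivrMr//.
have : 0 <= x ^+ 2 * (1 - 2 * x) by rewrite mulr_ge0 ?sqr_ge0//; lra.
by lra.
Qed.

Lemma exprn_1D_le_expR (x : R) n : 0 <= 1 + x -> (1 + x) ^+ n <= expR (n%:R * x).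
Proof.
move=> x0; rewrite expRM_natl.
by apply: lerXn2r; rewrite ?nnegrE ?expR_ge0 ?expR_ge1Dx.
Qed.

Lemma prod_1D_le_expR (I : finType) (w : I -> R) : (forall i, 0 <= w i) ->
  \prod_i (1 + w i) <= expR (\sum_i w i).
Proof.
move=> w0; rewrite expR_sum; apply: ler_prod => i _.
by rewrite addr_ge0//= expR_ge1Dx.
Qed.

End exponential_estimates.

(** * Uniform points in a bounded region *)

Section distinct_points.
Context {dT : measure_display} {T : measurableType dT} {R : realType}.
Hypothesis measurable_diagonal : measurable [set p : T * T | p.1 = p.2].

Let measurable_eq {dS : measure_display} {S : measurableType dS} (f g : S -> T) :
  measurable_fun setT f -> measurable_fun setT g ->
  measurable [set x | f x = g x].
Proof.
move=> mf mg; rewrite -[X in measurable X]setTI.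
exact: (measurable_fun_pair mf mg measurableT measurable_diagonal).
Qed.

Lemma measurable_uniq n : measurable [set t : n.-tuple T | uniq t].
Proof.
rewrite (_ : [set t | _] = \bigcap_(p in [set: 'I_n * 'I_n])
    [set t : n.-tuple T | p.1 != p.2 -> tnth t p.1 <> tnth t p.2]); last first.
  apply/seteqP; split => t /=.
    by move=> /tuple_uniqP tI -[i j] _ /= /eqP ij /tI /ij.
  move=> H; apply/tuple_uniqP => i j tij; apply/eqP; apply: contraPT tij => ij.
  exact: (H (i, j)).
apply: fin_bigcap_measurable => [|[i j] _ /=]; first exact: finite_finset.
have [->|ij] := eqVneq i j.
  by rewrite (_ : [set t | _] = setT)//; apply/seteqP; split.
rewrite (_ : [set t | _] = ~` [set t : n.-tuple T | tnth t i = tnth t j]).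
  apply: measurableC; apply: measurable_eq; exact: measurable_tnth.
by apply/seteqP; split => t /=; [exact|].
Qed.

Variable mu : {sigma_finite_measure set T -> \bar R}.
Hypotheses (mu1 : mu setT = 1%E) (mu_atomless : forall x, mu [set x] = 0%E).

Lemma mpower_notin n (x : T) : mpower mu n [set t | x \in (t : seq T)] = 0%E.
Proof.
have m1 : measurable [set x].
  rewrite (_ : [set x] = [set y | y = x])//.
  by apply: measurable_eq => //; exact: measurable_cst.
have mi (i : 'I_n) : measurable [set t : n.-tuple T | tnth t i = x].
  by apply: measurable_eq; [exact: measurable_tnth|exact: measurable_cst].
transitivity (mpower mu n
    (\big[setU/set0]_(i < n) [set t : n.-tuple T | tnth t i = x])).
  congr (mpower mu n _); rewrite -bigcup_seq; apply/seteqP; split => t /=.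
    by move=> /tnthP[i ->]; exists i => //=; rewrite mem_index_enum.
  by move=> [i _ <-]; exact: mem_tnth.
pose null B := measurable B /\ mpower mu n B = 0%E.
suff [] : null (\big[setU/set0]_(i < n) [set t | tnth t i = x]) by [].
apply: (@big_ind _ null) => [|B C [mB B0] [mC C0]|i _]; rewrite /null.
- by rewrite measure0.
- by rewrite null_set_setU//; split => //; exact: measurableU.
split => //.
(* Prescribing one coordinate gives a box with a null side. *)
pose A (j : 'I_n) := if j == i then [set x] else setT.
transitivity (mpower mu n [set t | forall j, A j (tnth t j)]).
  congr (mpower mu n _); apply/seteqP; split => t /=.
    by move=> ti j; rewrite /A; case: eqP => // ->.
  by move=> /(_ i); rewrite /A eqxx.
rewrite mpower_box; last by move=> j; rewrite /A; case: ifP.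
by rewrite (bigD1 i)//= /A eqxx mu_atomless mul0e.
Qed.

(** For a fixed first point, distinctness is that of the tail minus the null event that the tail
    hits this point. *)
Lemma mpower_uniq n : mpower mu n [set t | uniq t] = 1%E.
Proof.
elim: n => [|n IH].
  rewrite -(mpowerT 0 mu1); congr (mpower mu 0 _).
  by apply/seteqP; split => // t _; rewrite /= tuple0.
have mU := @measurable_uniq n.
have mU' := @measurable_uniq n.+1.
transitivity (\int[mpower mu n.+1]_x
    (\1_[set t : n.+1.-tuple T | uniq t] x : R)%:E)%E.
  by rewrite integral_indic// setIT.
rewrite integral_mpowerS; last 2 first.
- exact/measurable_EFinP/measurable_indic.
- by move=> x; rewrite lee_fin indicE.
transitivity (\int[mu]_x cst 1%E x)%E; last by rewrite integral_cst// mul1e.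
apply: eq_integral => x _ /=.
have mx : measurable [set t : n.-tuple T | x \in (t : seq T)].
  rewrite (_ : [set t | _] =
    \bigcup_(i in [set: 'I_n]) [set t : n.-tuple T | tnth t i = x]).
    apply: fin_bigcup_measurable => [|i _]; first exact: finite_finset.
    by apply: measurable_eq; [exact: measurable_tnth|exact: measurable_cst].
  apply/seteqP; split => t /=; first by move=> /tnthP[i ->]; exists i.
  by move=> [i _ <-]; exact: mem_tnth.
under eq_integral => t _.
  rewrite (_ : \1__ _ = \1_([set t : n.-tuple T | uniq t] `\`
    [set t | x \in (t : seq T)]) t); last first.
    rewrite !indicE; congr (nat_of_bool _)%:R; apply/idP/idP; rewrite !inE /=.
      by case/andP => /negP.
    by case=> ut /negP xt; rewrite xt.
  over.
rewrite integral_indic//; last exact: measurableD.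
have Uoo : (mpower mu n [set t | uniq t] < +oo)%E by rewrite IH ltry.
rewrite setIT (measureD mU mx Uoo) [X in (X - _)%E]IH.
rewrite (subset_measure0 _ _ (@subIsetr _ _ _) (mpower_notin n x))//.
- by rewrite sube0.
- exact: measurableI.
Qed.

End distinct_points.

(** * Distance, diagonal and volume in Euclidean space *)

Section euclidean_geometry.
Context {R : realType} {d : nat}.
Local Notation E := (d.-tuple (measurableTypeR R)).

Lemma eucl_distC (x y : E) : eucl_dist x y = eucl_dist y x.
Proof.
by congr Num.sqrt; apply: eq_bigr => i _; rewrite -[in LHS]opprB sqrrN.
Qed.

Lemma coord_le_eucl_dist (x y : E) i :
  `|(tnth x i : R) - (tnth y i : R)| <= eucl_dist x y.
Proof.
rewrite -sqrtr_sqr ler_wsqrtr// (bigD1 i)//= lerDl.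
by apply: sumr_ge0 => j _; exact: sqr_ge0.
Qed.

Lemma measurable_eucl_dist :
  measurable_fun setT (fun p : E * E => eucl_dist p.1 p.2).
Proof.
have mc (f : E * E -> E) i : measurable_fun setT f ->
    measurable_fun setT (fun p => tnth (f p) i : measurableTypeR R).
  exact: (measurableT_comp (@measurable_tnth _ _ d i)).
apply: (@measurableT_comp _ _ _ _ _ _ (@Num.sqrt R)).
  by apply: continuous_measurable_fun; exact: sqrt_continuous.
apply: measurable_sum => i; apply: measurable_funX.
by apply: measurable_funB; exact: mc.
Qed.

Lemma measurable_diagonal_tuple : measurable [set p : E * E | p.1 = p.2].
Proof.
rewrite (_ : [set p | _] = (fun p : E * E => eucl_dist p.1 p.2) @^-1` [set 0]).
  by rewrite -[X in measurable X]setTI; exact: measurable_eucl_dist.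
apply/seteqP; split => -[x y] /=.
  move=> ->; rewrite /eucl_dist big1 ?sqrtr0// => i _.
  by rewrite subrr expr0n.
move=> H; apply: eq_from_tnth => i; apply/eqP; rewrite -subr_eq0 -normr_le0.
by rewrite -H; exact: coord_le_eucl_dist.
Qed.

(** In dimension 0 the space is a single point of volume 1. *)
Lemma vol_set1 (x : E) : (0 < d)%N -> vol [set x] = 0%E.
Proof.
move=> d0; rewrite (_ : [set x] = [set t | forall i, [set tnth x i] (tnth t i)]).
  rewrite /vol (mpower_box _ (A := fun i => [set tnth x i]))//.
  by rewrite (bigD1 (Ordinal d0))//= lebesgue_measure_set1 mul0e//.
apply/seteqP; split => t /=; first by move=> ->.
by move=> H; exact: eq_from_tnth.
Qed.

(** A cube of side twice the diameter, centred at any point of L, contains L. *)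
Lemma vol_lty (L : set E) : (diam L < +oo)%E -> (vol L < +oo)%E.
Proof.
move=> dL; have [->|/set0P[x Lx]] := eqVneq L set0; first by rewrite measure0.
have dist_le y : L y -> ((eucl_dist x y)%:E <= diam L)%E.
  by move=> Ly; apply: ereal_sup_ubound; exists (x, y).
pose D := fine (diam L).
have DE : diam L = D%:E.
  rewrite fineK// fin_numElt dL andbT (lt_le_trans _ (dist_le x Lx))//.
  exact: ltNyr.
pose A i := `[(tnth x i : R) - D, (tnth x i : R) + D]%classic : set R.
apply: (@le_lt_trans _ _ (vol [set t : E | forall i, A i (tnth t i)])).
  apply: mpower_mono => y Ly i; rewrite /A /= in_itv /=.
  have := dist_le y Ly; rewrite DE lee_fin => /(le_trans (coord_le_eucl_dist x y i)).
  by rewrite ler_norml => /andP[h1 h2]; apply/andP; split; lra.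
have -> : vol [set t : E | forall i, A i (tnth t i)] =
    (\prod_(i < d) lebesgue_measure (A i))%E.
  by apply: mpower_box => i; exact: measurable_itv.
suff /andP[] : (0 <= \prod_(i < d) lebesgue_measure (A i) < +oo)%E by [].
apply: (@big_ind _ (fun z => 0 <= z < +oo)%E) => [|u v|i _].
- by rewrite lee01 ltry.
- by move=> /andP[u0 uy] /andP[v0 vy]; rewrite mule_ge0//= lte_mul_pinfty// ge0_fin_numE.
- by rewrite measure_ge0/= lebesgue_measure_itv/=; case: ifP => // _; rewrite -EFinB ltry.
Qed.

End euclidean_geometry.

(** * Integrals over the region as uniform expectations *)

Section uniform_measure.
Context {R : realType} {d : nat}.
Local Notation E := (d.-tuple (measurableTypeR R)).
Variables (L : set E) (mL : measurable L).
Hypotheses (L_gt0 : (0 < vol L)%E) (L_lty : (vol L < +oo)%E).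

Let V := fine (vol L).

Let volLE : vol L = V%:E.
Proof. by rewrite /V fineK// ge0_fin_numE// measure_ge0. Qed.

Lemma fine_vol_gt0 : 0 < V.
Proof. by rewrite -lte_fin -volLE. Qed.

Lemma uniform_onE A : uniform_on mL A = ((V^-1)%:E * vol (A `&` L))%E.
Proof.
rewrite -[LHS]/(mnormalize (mrestr vol mL) (dirac point) A) /mnormalize.
case: ifPn => [/orP[/eqP|/eqP]|_].
- change (vol (setT `&` L) = 0%E -> dirac point A = ((V^-1)%:E * vol (A `&` L))%E).
  by rewrite setTI => L0; move: L_gt0; rewrite L0 ltxx.
- change (vol (setT `&` L) = +oo%E ->
    dirac point A = ((V^-1)%:E * vol (A `&` L))%E).
  by rewrite setTI => Loo; move: L_lty; rewrite Loo ltxx.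
change (vol (A `&` L) * (fine (vol (setT `&` L)))^-1%:E =
  (V^-1)%:E * vol (A `&` L))%E.
by rewrite setTI muleC.
Qed.

Lemma uniform_on_set1 (x : E) : (0 < d)%N -> uniform_on mL [set x] = 0%E.
Proof.
move=> d0; apply/eqP; rewrite eq_le measure_ge0 andbT uniform_onE.
apply: (@le_trans _ _ ((V^-1)%:E * vol [set x])%E); last first.
  by rewrite vol_set1// mule0.
rewrite lee_wpmul2l//; last by apply: mpower_mono => y [].
by rewrite lee_fin invr_ge0 ltW// fine_vol_gt0.
Qed.

Lemma integral_uniform_on (f : E -> \bar R) : measurable_fun setT f ->
  (forall x, (0 <= f x)%E) ->
  (\int[vol]_(x in L) f x = V%:E * \int[uniform_on mL]_x f x)%E.
Proof.
move=> mf f0; have mfL : measurable_fun L f by exact: measurable_funTS.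
have Vi0 : 0 <= V^-1 by rewrite invr_ge0 ltW// fine_vol_gt0.
have LC0 : uniform_on mL (~` L) = 0%E.
  by rewrite uniform_onE setICl measure0 mule0.
rewrite (ge0_negligible_integral (measurableC mL) measurableT mf
  (fun x _ => f0 x) LC0).
(* The complement of L is null, and on subsets of L the uniform law is the volume divided by V. *)
rewrite setTD setCK (eq_measure_integral (mscale (NngNum Vi0) vol)); last first.
  move=> A mA AL; rewrite /mscale/= uniform_onE.
  by rewrite (_ : A `&` L = A)//; exact/setIidPl.
rewrite ge0_integral_mscale//= muleA -EFinM divff ?mul1e//.
by rewrite gt_eqF// fine_vol_gt0.
Qed.

Lemma integral_mpower_uniform_on k (f : k.-tuple E -> \bar R) :
  measurable_fun setT f -> (forall x, (0 <= f x)%E) ->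
  (\int[mpower vol k]_(x in [set x | forall i, L (tnth x i)]) f x =
   (V ^+ k)%:E * \int[mpower (uniform_on mL) k]_x f x)%E.
Proof.
have mB n : measurable [set x : n.-tuple E | forall i, L (tnth x i)].
  rewrite (_ : [set x | _] = \bigcap_(i in [set: 'I_n])
      ((fun t => tnth t i) @^-1` L)); last first.
    by apply/seteqP; split=> t /= Bt i; [move=> _; exact: Bt|exact: (Bt i)].
  apply: fin_bigcap_measurable => [|i _]; first exact: finite_finset.
  by rewrite -[X in measurable X]setTI; exact: measurable_tnth.
elim: k f => [|k IH] f mf f0.
  rewrite expr0 mul1e (_ : [set x | _] = setT)//.
  by apply/seteqP; split => // t _ [].
have mft x : measurable_fun setT (fun t : k.-tuple E => f (tcons (x, t))).
  exact: (measurableT_comp (measurableT_comp mf (@measurable_tcons _ _ k))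
    (measurable_pair1 x)).
have mfi : measurable_fun setT
    (fun x => (\int[mpower (uniform_on mL) k]_t f (tcons (x, t)))%E).
  apply: (measurable_fun_fubini_tonelli_F (f \o @tcons _ _ k)) => [|x];
    last exact: f0.
  exact: (measurableT_comp mf (@measurable_tcons _ _ k)).
rewrite [in RHS]integral_mpowerS// integral_mkcond integral_mpowerS; last 2 first.
- have := measurable_funS measurableT (@subsetT _ _) mf.
  by move=> /(_ [set x | forall i, L (tnth x i)]) /(measurable_restrictT _ (mB _)).
- by move=> x; rewrite patchE; case: ifP.
transitivity (\int[vol]_(x in L)
    ((V ^+ k)%:E * \int[mpower (uniform_on mL) k]_t f (tcons (x, t))))%E.
  rewrite [RHS]integral_mkcond; apply: eq_integral => x _.
  rewrite patchE; case: ifPn => [/set_mem xL|/negP xL].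
    rewrite -IH// [RHS]integral_mkcond; apply: eq_integral => t _.
    rewrite !patchE; congr (if _ then _ else _).
    apply/idP/idP; rewrite !inE /= => H i; first by have := H (lift ord0 i); rewrite tnthS.
    by case: (unliftP ord0 i) => [j ->|->] //; rewrite tnthS; exact: H.
  rewrite integral0_eq// => t _; rewrite patchE; case: ifPn => // /set_mem /(_ ord0) H.
  by case: xL; apply/mem_set.
have Vk : 0 <= V ^+ k by rewrite exprn_ge0// ltW// fine_vol_gt0.
have fi0 x : (0 <= \int[mpower (uniform_on mL) k]_t f (tcons (x, t)))%E.
  exact: integral_ge0.
rewrite ge0_integralZl//; last exact: measurable_funTS.
by rewrite integral_uniform_on// muleA -EFinM -exprSr.
Qed.

End uniform_measure.

(** * The point process and its discretization *)

Section point_process.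
Context {R : realType} {d q : nat}.
Local Notation E := (d.-tuple (measurableTypeR R)).
Variables (Gam : 'M[R]_q) (lam : 'I_q -> R).
Hypotheses (Gam_sym : Gam^T = Gam) (lam_ge0 : forall i, 0 <= lam i).

(** Unlike [graph_of], this relates a vertex to itself when its type has positive range; [hc_sum]
    reconciles the two for distinct points. *)
Definition overlap : rel (E * 'I_q) :=
  fun u v => eucl_dist u.1 v.1 < Gam u.2 v.2.

Lemma overlapC : symmetric overlap.
Proof.
by move=> u v; rewrite /overlap eucl_distC -[in LHS]Gam_sym mxE.
Qed.

Lemma measurable_overlap a b :
  measurable_fun setT (fun p : E * E => overlap (p.1, a) (p.2, b)).
Proof.
exact: (measurable_fun_ltr measurable_eucl_dist (measurable_cst (Gam a b))).
Qed.

Variables (L : set E) (mL : measurable L).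
Hypotheses (L_gt0 : (0 < vol L)%E) (L_lty : (vol L < +oo)%E).

Let V := fine (vol L).
Let mu := uniform_on mL.
Let mu1 : mu setT = 1%E := probability_setT mu.

Definition particle_term k : R :=
  V ^+ k / k`!%:R * mean_weight overlap lam mu k [::].

Lemma partition_functionE :
  partition_function L Gam lam = (\sum_(0 <= k <oo) (particle_term k)%:E)%E.
Proof.
rewrite /partition_function; apply: eq_eseriesr => k _.
pose phi (tau : {ffun 'I_k -> 'I_q}) (x : k.-tuple E) : R :=
  \prod_(i < k) \prod_(j < k | (i < j)%N)
    (Gam (tau i) (tau j) <= eucl_dist (tnth x i) (tnth x j))%R%:R.
have bphi tau : bounded_ge0 (phi tau).
  apply: bounded_ge0_prod => i; apply: bounded_ge0_prod => j.
  apply: bounded_ge0_bool; apply: measurable_fun_ler => //.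
  exact: (measurableT_comp measurable_eucl_dist
    (measurable_fun_pair (@measurable_tnth _ E k i) (@measurable_tnth _ E k j))).
have muk1 := mpowerT k mu1.
have l0 (tau : {ffun 'I_k -> 'I_q}) : 0 <= \prod_(i < k) lam (tau i).
  by apply: prodr_ge0.
transitivity (((k`!%:R^-1)%:E * \sum_(tau : {ffun 'I_k -> 'I_q})
  ((\prod_(i < k) lam (tau i)) *
   (V ^+ k * expect (mpower mu k) (phi tau)))%:E)%E).
  congr (_ * _)%E; apply: eq_bigr => tau _; rewrite EFinM; congr (_ * _)%E.
  rewrite EFinM -expectE// -integral_mpower_uniform_on//.
  - by case: (bphi tau) => mphi _ _; exact/measurable_EFinP.
  - by move=> x; rewrite lee_fin; case: (bphi tau).
rewrite sumEFin -EFinM; congr EFin; rewrite /particle_term.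
have -> : mean_weight overlap lam mu k [::] =
    \sum_(tau : {ffun 'I_k -> 'I_q})
      (\prod_(i < k) lam (tau i)) * expect (mpower mu k) (phi tau).
  under [RHS]eq_bigr => tau _ do rewrite -(expectZ muk1 (l0 tau) (bphi tau)).
  rewrite -expect_sum//; last by move=> tau; exact: bounded_ge0Z.
  congr expect; apply/funext => x; rewrite full_weightE.
  apply: eq_bigr => tau _; congr (_ * _); rewrite big1 ?mul1r//.
  apply: eq_bigr => i _; apply: eq_bigr => j _.
  by rewrite overlapC /overlap /= -leNgt.
rewrite !big_distrr /=; apply: eq_bigr => tau _.
by rewrite mulrCA; ring.
Qed.

Lemma graph_partition_functionE n (x : n.-tuple E) : uniq x ->
  graph_partition_function L Gam lam (point_set x) =
  hc overlap (fun v => V / n%:R * lam v.2) (vertices x) [::].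
Proof.
move=> ux; set X := point_set x.
have Xx y : (y \in X) = (y \in (x : seq E)).
  apply/imfsetP/idP => [[i _ ->]|/tnthP[i ->]]; first exact: mem_tnth.
  by exists i.
(* Distinctness enters here: it turns the weights into [V / n%:R * lam a]. *)
have sX : #|` X| = n.
  rewrite -[RHS](size_tuple x) (perm_size (uniq_perm (fset_uniq X) ux _))//.
have [s0 s0E] : exists s0 : seq X, map val s0 = x.
  exists (pmap insub (x : seq E)).
  rewrite (pmap_filter (insubK _)); apply/all_filterP/allP => y yx.
  by rewrite insubT ?Xx.
have us0 : uniq s0 by apply: (@map_uniq _ _ val); rewrite s0E.
have mem_s0 y : y \in s0.
  by rewrite -(mem_map val_inj) s0E -Xx; exact: valP.
pose emb (v : X * 'I_q) : E * 'I_q := (val v.1, v.2).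
pose s : seq (X * 'I_q) := [seq (y, a) | y <- s0, a <- enum 'I_q].
have us : uniq s.
  by apply: allpairs_uniq => //; [exact: enum_uniq|move=> [? ?] [? ?] _ _].
have sE : map emb s = vertices x.
  by rewrite /vertices -s0E /s map_allpairs allpairs_mapl.
rewrite -sE -[[::]]/(map emb [::]) hc_map hc_sum//; last first.
  by move=> u v; exact: overlapC.
apply: eq_big => [I|I _].
  rewrite [X in [&& X, _ & _]](_ : _ = true); last first.
    by apply/fintype.subsetP => -[y a] _; apply: allpairs_f => //; rewrite mem_enum.
  rewrite [X in [&& _, _ & X]](_ : _ = true) ?andbT//.
  exact/forall_inP.
by apply: eq_bigr => v _; rewrite /weight_of sX [lam _ * _]mulrC mulrAC.
Qed.

(** The mean number of particles in the process without interaction. *)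
Let s := V * \sum_a lam a.

Let V_ge0 : 0 <= V.
Proof. by rewrite ltW// fine_vol_gt0. Qed.

Let s_ge0 : 0 <= s.
Proof. by rewrite mulr_ge0// sumr_ge0. Qed.

Lemma particle_term_ge0 k : 0 <= particle_term k.
Proof. by rewrite mulr_ge0 ?mean_weight_ge0// divr_ge0// exprn_ge0. Qed.

Lemma particle_termS_le k :
  k.+1%:R * particle_term k.+1 <= s * particle_term k.
Proof.
have k0 : k.+1%:R != 0 :> R by rewrite pnatr_eq0.
have f0 : k`!%:R != 0 :> R by rewrite pnatr_eq0 -lt0n fact_gt0.
rewrite /particle_term factS natrM exprS.
rewrite [leLHS](_ : _ = V * (V ^+ k / k`!%:R) *
  mean_weight overlap lam mu k.+1 [::]); last first.
  by move: k.+1%:R k`!%:R k0 f0 => A B k0 f0; field; rewrite k0 f0.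
rewrite /s [leRHS](_ : _ = V * (V ^+ k / k`!%:R) *
  ((\sum_a lam a) * mean_weight overlap lam mu k [::])); last by ring.
rewrite ler_wpM2l ?mean_weightS_le//; last exact: measurable_overlap.
by rewrite mulr_ge0// divr_ge0// exprn_ge0.
Qed.

Lemma binomial_meanE n : (0 < n)%N ->
  binomial_mean overlap lam mu (V / n%:R) n [::] = thinned_sum particle_term n.
Proof.
move=> n0; apply: eq_bigr => k _; rewrite /particle_term -bin_ffact natrM.
rewrite expr_div_n; field.
by rewrite pnatr_eq0 -lt0n fact_gt0 expf_neq0// pnatr_eq0 -lt0n.
Qed.

(** The condition on n makes the factor positive; dividing by it bounds every partial sum, so Z is
    finite. *)
Lemma partition_function_bounds n : (0 < n)%N -> s ^+ 2 < 2 * n%:R ->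
  exists2 Z : R, partition_function L Gam lam = Z%:E &
    (1 - s ^+ 2 / (2 * n%:R)) * Z <= thinned_sum particle_term n <= Z.
Proof.
move=> n0 sn; have n0' : 0 < n%:R :> R by rewrite ltr0n.
set a := 1 - _; have a0 : 0 < a.
  by rewrite subr_gt0 ltr_pdivrMr ?mulr_gt0// mul1r.
have T0 k : (0 <= (particle_term k)%:E)%E by rewrite lee_fin particle_term_ge0.
have partial_le N : \sum_(k < N) particle_term k <= thinned_sum particle_term n / a.
  rewrite ler_pdivlMr// mulrC; exact: (thinned_sum_ge particle_term_ge0 s_ge0 particle_termS_le N n0).
have upper : (partition_function L Gam lam <= (thinned_sum particle_term n / a)%:E)%E.
  rewrite partition_functionE; apply: lime_le; first exact: is_cvg_nneseries.
  by apply: nearW => N; rewrite sumEFin lee_fin big_mkord.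
have lower : ((thinned_sum particle_term n)%:E <= partition_function L Gam lam)%E.
  rewrite partition_functionE.
  apply: le_trans (nneseries_lim_ge n.+1 (fun k _ _ => T0 k)).
  rewrite sumEFin lee_fin big_mkord; apply: thinned_sum_le.
  exact: particle_term_ge0.
have Zfin : partition_function L Gam lam \is a fin_num.
  by rewrite fin_numElt (lt_le_trans (ltNyr _) lower) (le_lt_trans upper (ltry _)).
exists (fine (partition_function L Gam lam)); first by rewrite fineK.
apply/andP; split; last by rewrite -lee_fin fineK.
by rewrite mulrC -ler_pdivlMr// -lee_fin fineK.
Qed.

(** * First and second moments for n uniform points *)

Section concentration.
Variable n : nat.
Hypotheses (n_gt0 : (0 < n)%N) (s_small : s <= 2^-1 * n%:R).

Let n0 : 0 < n%:R :> R. Proof. by rewrite ltr0n. Qed.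
Let c := V / n%:R.
Let x := s / n%:R.
Let c_ge0 : 0 <= c. Proof. by rewrite divr_ge0. Qed.
Let x_bounds : 0 <= x <= 2^-1.
Proof. by rewrite divr_ge0//= ler_pdivrMr. Qed.

Let sum_weights : \sum_a c * lam a = x.
Proof. by rewrite -big_distrr /= /x /s mulrAC. Qed.

Let prod_weights_le : \prod_a (1 + c * lam a) <= 1 + x + 2 * x ^+ 2.
Proof.
apply: le_trans (expR_le_quadratic x_bounds); rewrite -sum_weights.
by apply: prod_1D_le_expR => a; rewrite mulr_ge0.
Qed.

Let prod_weights_ge1 : 1 <= \prod_a (1 + c * lam a).
Proof.
have := multi_occupancy_ge0 lam_ge0 c_ge0; rewrite /multi_occupancy sum_weights.
by have /andP[? ?] := x_bounds; lra.
Qed.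

Let f (t : n.-tuple E) := hc overlap (fun v => c * lam v.2) (vertices t) [::].
Let M := expect (mpower mu n) f.

Lemma expect_hc_bounds :
  thinned_sum particle_term n <= M <=
    expR (2 * (s ^+ 2 / n%:R)) * thinned_sum particle_term n.
Proof.
have r0 := multi_occupancy_ge0 lam_ge0 c_ge0.
rewrite -binomial_meanE// mean_hc_ge//=; last exact: measurable_overlap.
apply: le_trans (mean_hc_le lam_ge0 measurable_overlap mu1 c_ge0 n [::]) _.
rewrite ler_wpM2r//.
  apply: sumr_ge0 => k _.
  by rewrite mulr_ge0 ?mean_weight_ge0// mulr_ge0// exprn_ge0.
apply: le_trans (exprn_1D_le_expR _ _) _; first by rewrite addr_ge0.
rewrite ler_expR.
apply: (@le_trans _ _ (n%:R * (2 * x ^+ 2))).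
  rewrite ler_wpM2l// /multi_occupancy sum_weights.
  by have := prod_weights_le; lra.
by rewrite le_eqVlt; apply/orP; left; apply/eqP; rewrite /x; field; rewrite lt0r_neq0.
Qed.

Lemma second_moment_hc :
  expect (mpower mu n) (fun t => f t ^+ 2) <= expR (s ^+ 2 / n%:R) * M ^+ 2.
Proof.
set b := \prod_a (1 + c * lam a) - 1.
have /andP[x0 x2] := x_bounds.
have b0 : 0 <= b by rewrite subr_ge0.
(* x + 2 x^2 <= 2 x because x <= 1/2; then n b^2 / 4 is at most n x^2 = s^2 / n. *)
have b2 : b <= 2 * x.
  have : 0 <= x * (2^-1 - x) by rewrite mulr_ge0// subr_ge0.
  by have := prod_weights_le; rewrite /b; lra.
have bf : bounded_ge0 f.
  exact: (bounded_ge0_hcT lam_ge0 measurable_overlap c_ge0).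
apply: le_trans (second_moment_mpower mu1 b0 bf _) _.
  exact: (bounded_influence_hc lam_ge0 measurable_overlap c_ge0).
rewrite ler_wpM2r ?sqr_ge0//.
apply: le_trans (exprn_1D_le_expR _ _) _.
  by rewrite addr_ge0// divr_ge0// sqr_ge0.
rewrite ler_expR [leRHS](_ : _ = n%:R * x ^+ 2); last first.
  by rewrite /x; field; rewrite lt0r_neq0.
rewrite ler_wpM2l// ler_pdivrMr// [leRHS](_ : _ = (2 * x) ^+ 2); last by ring.
by apply: lerXn2r => //; rewrite nnegrE// mulr_ge0.
Qed.

End concentration.

Lemma concentration n (eps p : R) : (0 < d)%N -> (0 < n)%N ->
  0 < eps <= 1 -> 0 < p <= 1 -> 32 * (s ^+ 2 / n%:R) <= p * eps ^+ 2 ->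
  ((1 - p)%:E <= uniform_points mL n
     [set x | (expR (- eps))%:E * partition_function L Gam lam <=
                (graph_partition_function L Gam lam (point_set x))%:E /\
              (graph_partition_function L Gam lam (point_set x))%:E <=
                (expR eps)%:E * partition_function L Gam lam])%E.
Proof.
move=> d0 n0 /andP[e0 e1] /andP[p0 p1]; set y := s ^+ 2 / n%:R => yp.
have n0' : 0 < n%:R :> R by rewrite ltr0n.
have n1 : 1 <= n%:R :> R by rewrite ler1n.
have y0 : 0 <= y by rewrite divr_ge0// sqr_ge0.
have e2 : eps ^+ 2 <= eps by rewrite expr2 ler_piMl// ltW.
have y32 : 32 * y <= eps ^+ 2.
  by apply: le_trans yp _; rewrite ler_piMl// sqr_ge0.
have yn : s ^+ 2 = y * n%:R by rewrite /y divfK// gt_eqF.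
(* s^2 = y n with y <= 1/32, which is below (n / 2)^2. *)
have s_small : s <= 2^-1 * n%:R.
  rewrite -(@ler_pXn2r _ 2)// ?nnegrE ?mulr_ge0// yn exprMn [n%:R ^+ 2]expr2 mulrA.
  rewrite ler_wpM2r//; apply: (@le_trans _ _ (2^-1 ^+ 2 * 1)).
    by lra.
  by rewrite ler_wpM2l// exprn_ge0.
have [|Z ZE /andP[Z1 Z2]] := partition_function_bounds n0.
  rewrite yn ltr_pM2r//; lra.
have /andP[M1 M2] := expect_hc_bounds n0 s_small.
have H2 := second_moment_hc n0 s_small.
set f := (fun t : n.-tuple E => hc overlap (fun v => V / n%:R * lam v.2)
  (vertices t) [::]) in M1 M2 H2.
set M := expect (mpower mu n) f in M1 M2 H2.
rewrite -/y in M2 H2.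
have bf : bounded_ge0 f.
  exact: (bounded_ge0_hcT lam_ge0 measurable_overlap (divr_ge0 V_ge0 (ltW n0'))).
have mun1 : mpower mu n setT = 1%E := mpowerT n mu1.
have M_ge1 : 1 <= M.
  rewrite -(expect_cst mun1 1); apply: le_expect => //.
    exact: bounded_ge0_cst.
  by move=> t; apply: hc_ge1 => v; rewrite mulr_ge0// divr_ge0.
have M0 : 0 < M by exact: lt_le_trans M_ge1.
have Z0 : 0 <= Z.
  apply: le_trans Z2; apply: sumr_ge0 => k _.
  by rewrite mulr_ge0 ?particle_term_ge0// divr_ge0// exprn_ge0.
have de0 : 0 < eps / 4 by rewrite divr_gt0.
set B := [set t | eps / 4 * M <= `|f t - M|].
have PB : (mpower mu n B <= p%:E)%E.
  apply: le_trans (chebyshev_ratio mun1 bf M0 de0 H2) _.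
  (* The 16 from (eps / 4)^2 and the 2 from exp(y) - 1 <= 2 y make up the constant 32 of the
     hypothesis. *)
  rewrite lee_fin ler_pdivrMr ?exprn_gt0//.
  have : expR y <= 1 + y + 2 * y ^+ 2 by apply: expR_le_quadratic; lra.
  have : 0 <= y * (2^-1 - y) by rewrite mulr_ge0//; lra.
  have -> : p * (eps / 4) ^+ 2 = p * eps ^+ 2 / 16 by field.
  by lra.
have mB : measurable B.
  have mf : measurable_fun setT f by case: bf.
  rewrite -[B]setTI (_ : B = (fun t => eps / 4 * M <= `|f t - M|) @^-1` [set true]).
    apply: measurable_fun_ler => //.
    apply: (@measurableT_comp _ _ _ _ _ _ (fun x : R => `|x|)) => //.
    exact: measurable_funB.
  by apply/seteqP; split.
have mU := @measurable_uniq _ _ (@measurable_diagonal_tuple R d) n.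
have PU := @mpower_uniq _ _ R (@measurable_diagonal_tuple R d) mu mu1
  (fun x => uniform_on_set1 mL L_gt0 L_lty x d0) n.
have H : ((1 - p)%:E <= mpower mu n ([set t : n.-tuple E | uniq t] `\` B))%E.
  have Uoo : (mpower mu n [set t | uniq t] < +oo)%E by rewrite PU ltry.
  rewrite (measureD mU mB Uoo) [X in (X - _)%E]PU EFinB leeB//.
  apply: le_trans PB; apply: le_measure; rewrite ?inE//; exact: measurableI.
(* Measurability was shown for the smaller event only; [mpower_mono] does not ask for it on the
   target. *)
apply: le_trans H _; apply: mpower_mono => t [ut /negP]; rewrite -ltNge ltr_norml => /andP[f1 f2] /=.
rewrite graph_partition_functionE// -/(f t) ZE -!EFinM !lee_fin; split.
- apply: (@le_trans _ _ ((1 - eps / 4) * M)); last by lra.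
  apply: (@le_trans _ _ ((1 - eps / 4) * ((1 - s ^+ 2 / (2 * n%:R)) * Z))).
    rewrite mulrA ler_wpM2r//.
    have -> : s ^+ 2 / (2 * n%:R) = y / 2 by rewrite /y; field; rewrite gt_eqF.
    (* y <= eps / 32 makes the discretization loss y / 2 at most eps / 64; the cross term eps y / 8
       is favourable. *)
    apply: (@le_trans _ _ (1 - eps / 4 - eps / 64)); last first.
      have : 0 <= eps * y by rewrite mulr_ge0// ltW.
      by lra.
    (* It suffices that (1 - 17 eps / 64)(1 + eps) >= 1, which holds as eps^2 <= eps. *)
    rewrite expRN -[leLHS]mul1r ler_pdivrMr ?expR_gt0//.
    have q0 : 0 <= 1 - eps / 4 - eps / 64 by lra.
    apply: le_trans (ler_wpM2l q0 (expR_ge1Dx eps)).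
    by lra.
  by rewrite ler_wpM2l//; [lra|exact: le_trans M1].
- apply: (@le_trans _ _ ((1 + eps / 4) * M)); first by lra.
  (* The exponents eps / 4 and 2 y <= eps / 16 add up to less than eps. *)
  apply: (@le_trans _ _ (expR (eps / 4) * (expR (2 * y) * Z))).
    apply: ler_pM => //; [lra|exact: ltW|exact: expR_ge1Dx|].
    by apply: le_trans M2 _; rewrite ler_wpM2l// expR_ge0.
  by rewrite mulrA -expRD ler_wpM2r// ler_expR; lra.
Qed.

End point_process.

Theorem theorem8p11 (R : realType) (d : nat) (d_gt0 : (0 < d)%N)
  (q : nat) (q_gt0 : (0 < q)%N)
  (Gam : 'M[R]_q) (Gam_sym : Gam^T = Gam) (Gam_ge0 : forall i j, 0 <= Gam i j)
  (lam : 'I_q -> R) (lam_ge0 : forall i, 0 <= lam i)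
  (kappa : R) (kappa01 : 0 < kappa <= 1) (P : {poly R}) :
  exists Q : {poly R},
  forall (L : set (d.-tuple (measurableTypeR R))) (mL : measurable L),
    (diam L < +oo)%E -> (0 < vol L)%E ->
    (forall eps : R, 0 < eps ->
       exists (m : nat) (F : 'I_m -> set (d.-tuple (measurableTypeR R))),
         m%:R <= P.[fine (vol L) / eps] /\ partitioning L kappa eps F) ->
  forall epsD p : R, 0 < epsD <= 1 -> 0 < p <= 1 ->
  exists n0 : nat, n0%:R <= Q.[fine (vol L) / (epsD * p)] /\
  forall n : nat, (n0 <= n)%N ->
    ((1 - p)%:E <=
     uniform_points mL n
       [set x | (expR (- epsD))%:E * partition_function L Gam lam <=
                  (graph_partition_function L Gam lam (point_set x))%:E /\
                (graph_partition_function L Gam lam (point_set x))%:E <=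
                  (expR epsD)%:E * partition_function L Gam lam])%E.
Proof.
(* At V / (eps p) this equals B / p + 1 for the threshold B below; B <= B / p since p <= 1. The
   coefficients do not depend on L. *)
exists ((32 * (\sum_a lam a) ^+ 2) *: 'X^2 + 1%:P) => L mL dL L0 _ eps p eps01 p01.
have Loo := vol_lty dL; have /andP[e0 e1] := eps01; have /andP[p0 p1] := p01.
set s := fine (vol L) * \sum_a lam a.
have pe0 : 0 < p * eps ^+ 2 by rewrite mulr_gt0// exprn_gt0.
pose B := 32 * s ^+ 2 / (p * eps ^+ 2).
have B0 : 0 <= B by rewrite divr_ge0 ?(ltW pe0)// mulr_ge0// sqr_ge0.
(* The successor exceeds B and forces n > 0; the constant 1 of the polynomial pays for it. *)
exists (Num.truncn B).+1; split.
  rewrite hornerD hornerZ hornerXn hornerC -natr1 lerD2r.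
  apply: le_trans (_ : B <= _); first by rewrite truncn_le.
  rewrite [leRHS](_ : _ = B / p); last first.
    by rewrite /B /s; field; rewrite !gt_eqF.
  by rewrite ler_pdivlMr// ler_piMr.
move=> n Bn; have n0 : (0 < n)%N by exact: leq_trans Bn.
have n0' : 0 < n%:R :> R by rewrite ltr0n.
apply: (concentration Gam_sym) => //.
rewrite mulrA ler_pdivrMr// -ler_pdivrMl// -/s mulrC -/B.
by apply: le_trans (ltW (truncnS_gt B)) _; rewrite ler_nat.
Qed.
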